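(* Let $\mathcal{H}$ be a separable Hilbert space with orthonormal basis $\{e_i\}_{i\in\mathbb{Z}}$ and let $\mathcal{A}=B_0(\mathcal{H})$ be the $C^*$-algebra of compact operators on $\mathcal{H}$. Let $N\ge 2$, let $W^{(l)}=(W^{(l)}_j)_{j\in\mathbb{Z}}$, $l=1,\dots,N$, be uniformly bounded sequences of invertible operators in $B(\mathcal{H})$ whose sequences of inverses $((W^{(l)}_j)^{-1})_{j\in\mathbb{Z}}$ are also uniformly bounded, and let $U^{(1)},\dots,U^{(N)}$ be unitary operators on $\mathcal{H}$. Assume that for each $m\in\mathbb{N}$ there exists $N_m\in\mathbb{N}$ such that for each $n\ge N_m$ and each pair of distinct $s,l\in\{1,\dots,N\}$ $$(U^{(s)})^{n}(U^{(l)})^{-n}(L_m)\perp L_m.$$ Then the following assertions are equivalent. (1) The operators $T_{U^{(1)},W^{(1)}},\dots,T_{U^{(N)},W^{(N)}}$ on $\ell_2(\mathcal{A})$ are densely disjoint hypercyclic. (2) For every $J,m\in\mathbb{N}$ there exist a strictly increasing sequence $\{n_k\}_k\subset\mathbb{N}$ and, for all $j\in[J]$, sequences $\{D^{(k)}_j\}_{k=1}^\infty$ and $\{G^{(k)}_{1,j}\}_{k=1}^\infty,\dots,\{G^{(k)}_{N,j}\}_{k=1}^\infty$ of operators in $B_0(\mathcal{H})$ such that for each $j\in[J]$ and $l\in\{1,\dots,N\}$ $$\lim_{k\to\infty}\|D^{(k)}_j-P_m\|=0,\qquad \lim_{k\to\infty}\|G^{(k)}_{l,j}-P_m\|=0,$$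 $$\lim_{k\to\infty}\|W^{(l)}_{j+n_k}W^{(l)}_{j+n_k-1}\cdots W^{(l)}_{j+1}D^{(k)}_j\|=0,$$ $$\lim_{k\to\infty}\|(W^{(l)}_{j-n_k+1})^{-1}(W^{(l)}_{j-n_k+2})^{-1}\cdots (W^{(l)}_{j})^{-1}G^{(k)}_{l,j}\|=0,$$ and, for each $j\in[J]$ and each pair of distinct $s,l\in\{1,\dots,N\}$, $$\lim_{k\to\infty}\|W^{(s)}_{j}W^{(s)}_{j-1}\cdots W^{(s)}_{j-n_k+1}(W^{(l)}_{j-n_k+1})^{-1}(W^{(l)}_{j-n_k+2})^{-1}\cdots (W^{(l)}_{j})^{-1}G^{(k)}_{l,j}\|=0.$$
   Context: $B(\mathcal{H})$ is the $C^*$-algebra of bounded linear operators on $\mathcal{H}$. $\ell_2(\mathcal{A})$ is the standard right Hilbert $\mathcal{A}$-module of sequences $x=(x_j)_{j\in\mathbb{Z}}$ in $\mathcal{A}$ such that $\sum_{j}x_j^*x_j$ converges in norm in $\mathcal{A}$, with norm $\|x\|=\|\sum_j x_j^*x_j\|^{1/2}$. For a unitary $U$ on $\mathcal{H}$ and a sequence $W=(W_j)_{j\in\mathbb{Z}}$ of invertible operators with $(W_j)$ and $(W_j^{-1})$ uniformly bounded, the generalized bilateral weighted shift $T_{U,W}$ on $\ell_2(\mathcal{A})$ is $(T_{U,W}(x))_n=W_nx_{n-1}U$, $n\in\mathbb{Z}$. For $J,m\in\mathbb{N}$, $[J]=\{-J,\dots,J\}$, $L_m=\mathrm{span}\{e_{-m},\dots,e_m\}$,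 and $P_m$ is the orthogonal projection of $\mathcal{H}$ onto $L_m$. Continuous linear operators $T_1,\dots,T_N$ ($N\ge2$) on a separable Banach space $X$ are disjoint hypercyclic if there is $x\in X$ such that $(x,\dots,x)\in X^N$ is a hypercyclic vector for $T_1\oplus\cdots\oplus T_N$, i.e. $\{(T_1^nx,\dots,T_N^nx):n\in\mathbb{N}_0\}$ (with $\mathbb{N}_0=\mathbb{N}\cup\{0\}$) is dense in $X^N$; such $x$ is a disjoint hypercyclic vector. They are densely disjoint hypercyclic if the set of disjoint hypercyclic vectors is dense in $X$. *)

(* Defs.v *)
From HB Require Import structures.
From mathcomp Require Import all_boot all_order all_algebra.
From mathcomp Require Import sesquilinear finmap complex.
From mathcomp Require Import all_classical all_reals.
From mathcomp Require Import topology normedtype showcase.summability.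

Set Implicit Arguments.
Unset Strict Implicit.
Unset Printing Implicit Defensive.

Import Order.TTheory GRing.Theory Num.Theory Num.Def.
Import numFieldNormedType.Exports.

Local Open Scope classical_set_scope.
Local Open Scope complex_scope.
Local Open Scope ring_scope.

(* The inner product is linear in its first argument and conjugate-linear in
   its second; norms on H are values of R[i] (real and nonnegative). *)
HB.mixin Record isHilbert (R : realType) H of CompleteNormedModule R[i] H := {
  inner : {dot H for (@conjC R[i])} ;
  inner_norm : forall x : H, inner x x = `|x| ^+ 2
}.

#[short(type="hilbertType")]
HB.structure Definition Hilbert (R : realType) :=
  {H of isHilbert R H & CompleteNormedModule R[i] H}.

Section BoundedOperators.
Context {R : realType} (H : hilbertType R).
Local Notation C := R[i].

Definition bounded_op : {pred H -> H} :=
  mem [set f : H -> H | linear f /\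
    exists2 M : C, 0 <= M & forall x, `|f x| <= M * `|x|].

Record bop := Bop { bop_fun :> H -> H ; bop_funP : bop_fun \in bounded_op }.

HB.instance Definition _ := [isSub for bop_fun].
HB.instance Definition _ := [Choice of bop by <:].

Lemma bounded_op_closed : submod_closed bounded_op.
Proof.
split=> [|a f g].
  rewrite inE; split=> [b x y|]; first by rewrite scaler0 addr0.
  by exists 0 => // x; rewrite normr0 mul0r.
rewrite !inE => -[lf [M M0 fM]] [lg [K K0 gK]]; split=> [b x y|].
  rewrite !fctE /= lf lg !scalerDr !scalerA mulrC -!addrA; congr (_ + _).
  by rewrite addrCA.
exists (`|a| * M + K) => [|x]; first by rewrite addr_ge0 ?mulr_ge0.
rewrite !fctE /= mulrDl (le_trans (ler_normD _ _))// lerD// normrZ -mulrA.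
by rewrite ler_wpM2l.
Qed.

HB.instance Definition _ :=
  GRing.isSubmodClosed.Build C (H -> H) bounded_op bounded_op_closed.
HB.instance Definition _ := [SubChoice_isSubLmodule of bop by <:].

Lemma bop1_subproof : idfun \in bounded_op.
Proof. by rewrite inE; split=> //; exists 1 => // x; rewrite mul1r. Qed.

Definition bop1 : bop := Bop bop1_subproof.

Lemma bop_mul_subproof (S T : bop) : S \o T \in bounded_op.
Proof.
have := bop_funP S; have := bop_funP T.
rewrite !inE => -[lT [M M0 TM]] [lS [K K0 SK]]; split=> [a x y|].
  by rewrite /= lT lS.
exists (K * M) => [|x]; first by rewrite mulr_ge0.
by rewrite (le_trans (SK _))// -mulrA ler_wpM2l.
Qed.

Definition bop_mul (S T : bop) : bop := Bop (bop_mul_subproof S T).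

Lemma bop_eq (S T : bop) : S =1 T -> S = T.
Proof. by move=> ST; apply/val_inj/funext. Qed.

Lemma bopD (T : bop) x y : T (x + y) = T x + T y.
Proof.
have := bop_funP T; rewrite inE => -[lT _].
by rewrite -[x]scale1r lT !scale1r.
Qed.

Lemma bop_mulA : associative bop_mul.
Proof. by move=> A B D; apply: bop_eq. Qed.
Lemma bop_mul1l : left_id bop1 bop_mul.
Proof. by move=> A; apply: bop_eq. Qed.
Lemma bop_mul1r : right_id bop1 bop_mul.
Proof. by move=> A; apply: bop_eq. Qed.
Lemma bop_mulDl : left_distributive bop_mul +%R.
Proof. by move=> A B D; apply: bop_eq. Qed.
Lemma bop_mulDr : right_distributive bop_mul +%R.
Proof. by move=> A B D; apply: bop_eq => x; exact: bopD. Qed.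

HB.instance Definition _ := GRing.Zmodule_isPzRing.Build bop
  bop_mulA bop_mul1l bop_mul1r bop_mulDl bop_mulDr.

Definition opnorm (T : bop) : R :=
  sup [set complex.Re `|T x| | x in [set x : H | `|x| <= 1]].

Definition is_adjoint (T S : bop) := forall x y, inner (T x) y = inner x (S y).

(* The default value 0 is never used: by the Riesz representation theorem every
   bounded operator has an adjoint, and it is unique. *)
Definition adjoint (T : bop) : bop := xget 0 (is_adjoint T).

Definition is_inverse (T S : bop) := S * T = 1 /\ T * S = 1.
Definition invertible (T : bop) := exists S, is_inverse T S.

(* Equal to 0 when T is not invertible. *)
Definition inverse (T : bop) : bop := xget 0 (is_inverse T).

Definition unitary (T : bop) := is_inverse T (adjoint T).

Definition compact_op : set bop :=
  [set T | compact (closure (T @` [set x : H | `|x| <= 1]))].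

Definition uniformly_bounded (W : int -> bop) :=
  exists M : R, forall j, opnorm (W j) <= M.

Definition orthogonal_sets (A B : set H) :=
  forall x y, A x -> B y -> inner x y = 0.

Definition is_orthoproj (L : set H) (P : bop) :=
  (forall x, L (P x)) /\ (forall x, orthogonal_sets [set x - P x] L).

(* Meaningful only for closed subspaces L, where P exists and is unique. *)
Definition orthoproj (L : set H) : bop := xget 0 (is_orthoproj L).

End BoundedOperators.

Section Basis.
Context {R : realType} {H : hilbertType R} (e : int -> H).

Definition Lspan (m : nat) : set H :=
  [set x | exists c : 'I_m.*2.+1 -> R[i],
     x = \sum_(i < m.*2.+1) c i *: e (i%:Z - m%:Z)].

Definition orthonormal_basis :=
  (forall i j, inner (e i) (e j) = (i == j)%:R) /\ dense (\bigcup_m Lspan m).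

End Basis.

(* Density and disjoint hypercyclicity in a normed space given as a subset X of
   an ambient additive group V, with a norm nrm that is meaningful on X. *)
Section DisjointHypercyclicity.
Context {R : realType}.

Definition norm_dense (V : zmodType) (X : set V) (nrm : V -> R) (D : set V) :=
  D `<=` X /\
  forall y, X y -> forall eps : R, 0 < eps -> exists2 x, D x & nrm (x - y) < eps.

Definition hypercyclic_vector (V : zmodType) (X : set V) (nrm : V -> R)
    (T : V -> V) (x : V) :=
  norm_dense X nrm (range (fun n => iter n T x)).

Context {V : zmodType} (X : set V) (nrm : V -> R) {N : nat} (T : 'I_N -> V -> V).

Definition power_space : set ('I_N -> V) := [set y | forall l, X (y l)].
Definition power_norm (y : 'I_N -> V) : R := \big[Num.max/0]_(l < N) nrm (y l).

Definition direct_sum (y : 'I_N -> V) : 'I_N -> V := fun l => T l (y l).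

Definition disjoint_hypercyclic_vector : set V :=
  [set x | X x /\ hypercyclic_vector power_space power_norm direct_sum (fun=> x)].

Definition densely_disjoint_hypercyclic :=
  norm_dense X nrm disjoint_hypercyclic_vector.

End DisjointHypercyclicity.

Section HilbertModule.
Context {R : realType} (H : hilbertType R).

(* S is the norm limit in A = B_0(H) of the net of the finite sums of
   the x_j^* x_j. *)
Definition l2_sum (x : int -> bop H) (S : bop H) :=
  compact_op S /\
  opnorm (partial_sum (fun j => adjoint (x j) * x j) F - S)
    @[F --> totally] --> (0 : R).

Definition l2A : set (int -> bop H) :=
  [set x | (forall j, compact_op (x j)) /\ exists S, l2_sum x S].

(* The sum S is unique when x belongs to l2A. *)
Definition l2A_norm (x : int -> bop H) : R :=
  Num.sqrt (opnorm (xget 0 (l2_sum x))).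

Definition weighted_shift (U : bop H) (W : int -> bop H)
    (x : int -> bop H) : int -> bop H :=
  fun n => W n * x (n - 1) * U.

(* W_{j+n} W_{j+n-1} ... W_{j+1} *)
Definition forward_prod (W : int -> bop H) (j : int) (n : nat) : bop H :=
  \prod_(i < n) W (j + n%:Z - i%:Z).

(* W_j W_{j-1} ... W_{j-n+1} *)
Definition forward_prod_to (W : int -> bop H) (j : int) (n : nat) : bop H :=
  \prod_(i < n) W (j - i%:Z).

(* W_{j-n+1}^{-1} W_{j-n+2}^{-1} ... W_j^{-1} *)
Definition backward_prod (W : int -> bop H) (j : int) (n : nat) : bop H :=
  \prod_(i < n) inverse (W (j - n%:Z + 1 + i%:Z)).

End HilbertModule.

(* Main.v *)
(** Condition (2) amounts to its finitary form [shift_criterion], with one error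
    bound [eps] and arbitrarily large [n].

    (2) => (1). For finitely supported [u] and [y_l] whose entries have range in
    [L_m], put [D_j u_j] at the coordinates [j] and add, at the coordinates
    [j - n], the operators [B_l G_(l, j) y_(l, j) U_l ^ (- n)], where [B_l] is the
    backward product.  The sequence obtained is l1-close to [u] and its image
    under the [n]-th power of the [l]-th shift is l1-close to [y_l], for all [l]
    at once.  Running through a countable dense family of targets with shrinking
    radii gives a disjoint hypercyclic vector near any given sequence.

    (1) => (2). If a disjoint hypercyclic vector [x] is close to [P_m] on [[J]] and
    the [n]-th iterates approximate [P_m] on [[J]] as well, then [D_j = x_j] and
    [G_(l, j) = W_j .. W_(j - n + 1) x_(j - n) U_l ^ n] satisfy everything but the
    cross conditions, which involve compressions of [U_s ^ (- n) U_l ^ n].  So the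
    targets are composed with partial isometries onto blocks of basis vectors that
    depend on [l]; by Bessel's inequality and averaging, for each [n] some choice
    of blocks makes [U_l ^ n] of the [l]-th block almost orthogonal to [U_s ^ n] of
    the [s]-th one.  As the choice depends on [n], the target contains one window
    for each choice, at different distances from the origin, and [n] is corrected
    by the distance of the window used. *)
Require Import Defs.
From HB Require Import structures.
From mathcomp Require Import all_boot all_order all_algebra.
From mathcomp Require Import sesquilinear finmap complex lra ring zify.
From mathcomp Require Import all_classical all_reals.
From mathcomp Require Import topology normedtype showcase.summability.

Set Implicit Arguments.
Unset Strict Implicit.
Unset Printing Implicit Defensive.

Import Order.TTheory GRing.Theory Num.Theory Num.Def.
Import numFieldNormedType.Exports.
Local Open Scope classical_set_scope.
Local Open Scope complex_scope.
Local Open Scope ring_scope.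

(** * Norms with real values *)

Section RealNorm.
Context {R : realType} {V : normedZmodType R[i]}.
Implicit Types x y z : V.

(** The norm of [V] is an element of [R[i]]; its real part lies in the ordered field [R], where
    suprema, square roots and real arithmetic apply. *)
Definition rnorm x : R := complex.Re `|x|.

Lemma rnormE x : `|x| = (rnorm x)%:C.
Proof. by rewrite RRe_real ?normr_real. Qed.

Lemma rnorm_ge0 x : 0 <= rnorm x.
Proof. by rewrite -lecR -rnormE normr_ge0. Qed.
Hint Resolve rnorm_ge0 : core.

Lemma ler_rnormD x y : rnorm (x + y) <= rnorm x + rnorm y.
Proof. by rewrite -lecR rmorphD /= -!rnormE ler_normD. Qed.

Lemma rnormN x : rnorm (- x) = rnorm x.
Proof. by rewrite /rnorm normrN. Qed.

Lemma ler_rnormB x y : rnorm (x - y) <= rnorm x + rnorm y.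
Proof. by rewrite -(rnormN y) ler_rnormD. Qed.

Lemma rdistC x y : rnorm (x - y) = rnorm (y - x).
Proof. by rewrite /rnorm distrC. Qed.

Lemma ler_rdistD z x y : rnorm (x - y) <= rnorm (x - z) + rnorm (z - y).
Proof. by rewrite -lecR rmorphD /= -!rnormE ler_distD. Qed.

Lemma rnorm0 : rnorm 0 = 0.
Proof. by rewrite /rnorm normr0. Qed.

Lemma rnorm_eq0 x : (rnorm x == 0) = (x == 0).
Proof. by rewrite -(normr_eq0 x) rnormE -(inj_eq (@complexI R)). Qed.

End RealNorm.
#[global] Hint Extern 0 (is_true (0 <= rnorm _)) => solve [exact: rnorm_ge0] : core.

Section ComplexRealNorm.
Context {R : realType}.
Implicit Types a b : R[i].

Lemma rnormM a b : rnorm (a * b) = rnorm a * rnorm b.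
Proof. by apply: (@complexI R); rewrite rmorphM /= -!rnormE normrM. Qed.

Lemma rnorm_sqr a : rnorm a ^+ 2 = complex.Re a ^+ 2 + complex.Im a ^+ 2.
Proof. by apply: (@complexI R); rewrite add_Re2_Im2 rnormE rmorphXn. Qed.

Lemma rnormZ (V : normedModType R[i]) a (x : V) :
  rnorm (a *: x) = rnorm a * rnorm x.
Proof. by apply: (@complexI R); rewrite rmorphM /= -!rnormE normrZ. Qed.

Lemma rnorm_real (t : R) : rnorm t%:C = `|t|.
Proof.
by apply/eqP; rewrite -(@eqrXn2 _ 2)// rnorm_sqr /= expr0n addr0 real_normK ?num_real.
Qed.

Lemma ler_rnormRe a : `|complex.Re a| <= rnorm a.
Proof. by rewrite -lecR -rnormE; exact: normc_ge_Re. Qed.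

End ComplexRealNorm.

(** * Inner product and the Cauchy-Schwarz inequality *)

Section InnerProduct.
Context {R : realType} {H : hilbertType R}.
Implicit Types x y z : H.

Lemma innerDl x y z : inner (x + y) z = inner x z + inner y z.
Proof. exact: linearDl. Qed.

Lemma innerDr x y z : inner z (x + y) = inner z x + inner z y.
Proof. exact: linearDr. Qed.

Lemma innerZl a x y : inner (a *: x) y = a * inner x y.
Proof. exact: linearZl_LR. Qed.

Lemma innerZr a x y : inner x (a *: y) = a^*%C * inner x y.
Proof. by rewrite linearZr_LR. Qed.

Lemma inner0l x : inner 0 x = 0.
Proof. exact: linear0l. Qed.

Lemma inner0r x : inner x 0 = 0.
Proof. exact: linear0r. Qed.

Lemma innerNl x y : inner (- x) y = - inner x y.
Proof. exact: linearNl. Qed.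

Lemma innerNr x y : inner x (- y) = - inner x y.
Proof. exact: linearNr. Qed.

Lemma innerBl x y z : inner (x - y) z = inner x z - inner y z.
Proof. by rewrite innerDl innerNl. Qed.

Lemma innerBr x y z : inner z (x - y) = inner z x - inner z y.
Proof. by rewrite innerDr innerNr. Qed.

Lemma inner_suml I (r : seq I) (P : pred I) (F : I -> H) y :
  inner (\sum_(i <- r | P i) F i) y = \sum_(i <- r | P i) inner (F i) y.
Proof.
by apply: (big_morph (fun u => inner u y)) => [u v|]; rewrite ?innerDl ?inner0l.
Qed.

Lemma inner_sumr I (r : seq I) (P : pred I) (F : I -> H) y :
  inner y (\sum_(i <- r | P i) F i) = \sum_(i <- r | P i) inner y (F i).
Proof. by apply: (big_morph (inner y)) => [u v|]; rewrite ?innerDr ?inner0r. Qed.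

Lemma innerC x y : inner x y = (inner y x)^*%C.
Proof. by have := hermC (inner : {hermitian H for false & _}) x y; rewrite expr0 mul1r. Qed.

(** A symmetric real bilinear form inducing the same norm: squares of norms expand in [R] without
    complex conjugates. *)
Definition rinner x y : R := complex.Re (inner x y).

Lemma rinnerC x y : rinner x y = rinner y x.
Proof. by rewrite /rinner innerC; case: (inner y x). Qed.

Lemma rinnerDl x y z : rinner (x + y) z = rinner x z + rinner y z.
Proof. by rewrite /rinner innerDl raddfD. Qed.

Lemma rinnerDr x y z : rinner z (x + y) = rinner z x + rinner z y.
Proof. by rewrite /rinner innerDr raddfD. Qed.

Lemma rinnerNl x y : rinner (- x) y = - rinner x y.
Proof. by rewrite /rinner innerNl raddfN. Qed.

Lemma rinnerNr x y : rinner x (- y) = - rinner x y.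
Proof. by rewrite /rinner innerNr raddfN. Qed.

Lemma rinnerZl (t : R) x y : rinner (t%:C *: x) y = t * rinner x y.
Proof. by rewrite /rinner innerZl; case: (inner x y) => a b /=; rewrite mul0r subr0. Qed.

Lemma rinnerZr (t : R) x y : rinner x (t%:C *: y) = t * rinner x y.
Proof. by rewrite rinnerC rinnerZl rinnerC. Qed.

Lemma rinner_suml I (r : seq I) (P : pred I) (F : I -> H) y :
  rinner (\sum_(i <- r | P i) F i) y = \sum_(i <- r | P i) rinner (F i) y.
Proof. by rewrite /rinner inner_suml raddf_sum. Qed.

Lemma rinnerxx x : rinner x x = rnorm x ^+ 2.
Proof. by rewrite /rinner inner_norm rnormE -rmorphXn. Qed.

Lemma inner_inj x y : (forall z, rinner x z = rinner y z) -> x = y.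
Proof.
move=> xy; apply/eqP; rewrite -subr_eq0 -rnorm_eq0 -sqrf_eq0 -rinnerxx.
by rewrite rinnerDl rinnerNl xy subrr.
Qed.

Lemma rnormD_sqr x y : rnorm (x + y) ^+ 2 = rnorm x ^+ 2 + rinner x y *+ 2 + rnorm y ^+ 2.
Proof. by rewrite -!rinnerxx rinnerDl !rinnerDr (rinnerC y x); ring. Qed.

Lemma rnormB_sqr x y : rnorm (x - y) ^+ 2 = rnorm x ^+ 2 - rinner x y *+ 2 + rnorm y ^+ 2.
Proof. by rewrite rnormD_sqr rinnerNr rnormN mulNrn. Qed.

(** Change the sign of [x] if necessary, then expand the square norm of $\|y\|x-\|x\|y$, which is
    nonnegative. *)
Lemma rinner_le x y : `|rinner x y| <= rnorm x * rnorm y.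
Proof.
wlog: x / 0 <= rinner x y => [hw|xy0].
  case: (leP 0 (rinner x y)) => [/hw//|lt0]; rewrite -normrN -rinnerNl -(rnormN x).
  by apply: hw; rewrite rinnerNl oppr_ge0 ltW.
rewrite ger0_norm//.
have [->|y0] := eqVneq y 0; first by rewrite rnorm0 mulr0 /rinner inner0r.
have [->|x0] := eqVneq x 0; first by rewrite rnorm0 mul0r /rinner inner0l.
have X0 : 0 < rnorm x by rewrite lt_def rnorm_eq0 x0 rnorm_ge0.
have Y0 : 0 < rnorm y by rewrite lt_def rnorm_eq0 y0 rnorm_ge0.
have : 0 <= rnorm ((rnorm y)%:C *: x - (rnorm x)%:C *: y) ^+ 2 by exact: sqr_ge0.
rewrite rnormB_sqr rinnerZl rinnerZr !rnormZ !rnorm_real !ger0_norm//.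
have XY := mulr_gt0 X0 Y0.
rewrite [X in 0 <= X](_ : _ = (rnorm x * rnorm y *+ 2) * (rnorm x * rnorm y - rinner x y)); last by ring.
by rewrite pmulr_rge0 ?subr_ge0// pmulrn_lgt0.
Qed.

(** Multiplying [y] by the scalar [inner x y] turns the inner product into its squared modulus,
    which is real, so that [rinner_le] applies. *)
Lemma inner_le x y : rnorm (inner x y) <= rnorm x * rnorm y.
Proof.
have [->|c0] := eqVneq (inner x y) 0; first by rewrite rnorm0 mulr_ge0.
have C0 : 0 < rnorm (inner x y) by rewrite lt_def rnorm_eq0 c0 rnorm_ge0.
rewrite -(ler_pM2l C0) mulrCA -rnormZ -expr2.
apply: le_trans (rinner_le _ _); rewrite /rinner innerZr mulrC -sqr_normc.
by rewrite rnormE -rmorphXn /= ler_norm.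
Qed.

End InnerProduct.

(** * The operator norm *)

Section BoundedOperatorTheory.
Context {R : realType} {H : hilbertType R}.
Implicit Types (S T : bop H) (x y : H).

Lemma bounded_opP (f : H -> H) (M : R) : linear f ->
  (forall x, rnorm (f x) <= M * rnorm x) -> f \in @bounded_op R H.
Proof.
move=> lf fM; rewrite inE; split=> //; exists `|M|%:C => [|x].
  by rewrite -[0]/(0%:C) lecR.
rewrite !rnormE -rmorphM lecR (le_trans (fM x))// ler_wpM2r// ler_norm//.
Qed.

Lemma bop_linear T : linear T.
Proof. by have := bop_funP T; rewrite inE => -[]. Qed.

Lemma bopZ T a x : T (a *: x) = a *: T x.
Proof.
have T0 : T 0 = 0 by apply: (@addrI _ (T 0)); rewrite -bopD !addr0.
by rewrite -[a *: x]addr0 bop_linear T0 addr0.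
Qed.

Lemma bop0 T : T 0 = 0.
Proof. by rewrite -[X in T X](scale0r 0) bopZ scale0r. Qed.

Lemma bopN T x : T (- x) = - T x.
Proof. by rewrite -scaleN1r bopZ scaleN1r. Qed.

Lemma bopB T x y : T (x - y) = T x - T y.
Proof. by rewrite bopD bopN. Qed.

Lemma bop_sum T I (r : seq I) (P : pred I) (F : I -> H) :
  T (\sum_(i <- r | P i) F i) = \sum_(i <- r | P i) T (F i).
Proof. by apply: (big_morph T) => [u v|]; rewrite ?bopD ?bop0. Qed.

Lemma bopME S T x : (S * T) x = S (T x). Proof. by []. Qed.
Lemma bopDE S T x : (S + T) x = S x + T x. Proof. by []. Qed.
Lemma bopBE S T x : (S - T) x = S x - T x. Proof. by []. Qed.
Lemma bopZE a S x : (a *: S) x = a *: S x. Proof. by []. Qed.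
Lemma bop0E x : (0 : bop H) x = 0. Proof. by []. Qed.
Lemma bop1E x : (1 : bop H) x = x. Proof. by []. Qed.

Lemma bop_sumE I (r : seq I) (P : pred I) (F : I -> bop H) x :
  (\sum_(i <- r | P i) F i) x = \sum_(i <- r | P i) F i x.
Proof. exact: (big_morph (fun S : bop H => S x)). Qed.

Lemma bop_bound T : exists M : R, forall x, rnorm (T x) <= M * rnorm x.
Proof.
have := bop_funP T; rewrite inE => -[_ [M M0 TM]].
exists (complex.Re M) => x; rewrite -lecR rmorphM /= -!rnormE RRe_real//.
exact: ger0_real.
Qed.

Lemma opnorm_has_sup T :
  has_sup [set complex.Re `|T x| | x in [set x : H | `|x| <= 1]].
Proof.
split; first by exists (rnorm (T 0)); exists 0 => //=; rewrite normr0.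
have [M TM] := bop_bound T; exists `|M| => _ [x /= x1 <-].
apply: le_trans (TM x) _.
have : rnorm x <= 1 by rewrite -lecR -rnormE.
move=> x1'; apply: (@le_trans _ _ (`|M| * rnorm x)).
  by rewrite ler_wpM2r// ler_norm.
by rewrite ler_piMr.
Qed.

Lemma opnorm_ge0 T : 0 <= opnorm T.
Proof.
apply: le_trans (rnorm_ge0 (T 0)) _; apply: ub_le_sup.
  by case: (opnorm_has_sup T).
by exists 0 => //=; rewrite normr0.
Qed.

Lemma rnorm_le T x : rnorm (T x) <= opnorm T * rnorm x.
Proof.
have [->|x0] := eqVneq x 0; first by rewrite bop0 rnorm0 mulr0.
have X0 : 0 < rnorm x by rewrite lt_def rnorm_eq0 x0 rnorm_ge0.
rewrite -ler_pdivrMr// mulrC; set t := (rnorm x)^-1.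
have t0 : 0 <= t by rewrite invr_ge0.
have -> : t * rnorm (T x) = rnorm (T (t%:C *: x)).
  by rewrite bopZ rnormZ rnorm_real ger0_norm.
apply: ub_le_sup; first by case: (opnorm_has_sup T).
exists (t%:C *: x) => //=; rewrite rnormE -[1]/(1%:C) lecR.
by rewrite rnormZ rnorm_real ger0_norm// mulVf// gt_eqF.
Qed.

Lemma opnorm_le T (M : R) : 0 <= M ->
  (forall x, rnorm (T x) <= M * rnorm x) -> opnorm T <= M.
Proof.
move=> M0 TM; apply: ge_sup; first by case: (opnorm_has_sup T).
move=> _ [x /= x1 <-]; apply: le_trans (TM x) _.
by rewrite ler_piMr// -lecR -rnormE.
Qed.

Lemma opnorm_le_ball T (M : R) : (forall x, rnorm x <= 1 -> rnorm (T x) <= M) -> opnorm T <= M.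
Proof.
move=> TM; apply: ge_sup; first by case: (opnorm_has_sup T).
by move=> _ [x /= x1 <-]; apply: TM; rewrite -lecR -rnormE.
Qed.

Lemma rnorm_le1 T x : rnorm x <= 1 -> rnorm (T x) <= opnorm T.
Proof. by move=> x1; rewrite (le_trans (rnorm_le T x))// ler_piMr// opnorm_ge0. Qed.

Lemma opnorm_le_rinner T (M : R) : 0 <= M ->
  (forall x y, rinner (T x) y <= M * (rnorm x * rnorm y)) -> opnorm T <= M.
Proof.
move=> M0 TM; apply: opnorm_le => // x.
have [->|x0] := eqVneq (rnorm (T x)) 0; first by rewrite mulr_ge0.
have X0 : 0 < rnorm (T x) by rewrite lt_def x0 rnorm_ge0.
by have := TM x (T x); rewrite rinnerxx expr2 mulrA ler_pM2r.
Qed.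

Lemma opnorm_le_rinner1 T (M : R) : 0 <= M ->
  (forall x y, rnorm x <= 1 -> rnorm y <= 1 -> rinner (T x) y <= M) ->
  opnorm T <= M.
Proof.
move=> M0 TM; apply: opnorm_le_rinner => // x y.
have [->|x0] := eqVneq x 0; first by rewrite bop0 rnorm0 mul0r mulr0 /rinner inner0l.
have [->|y0] := eqVneq y 0; first by rewrite rnorm0 !mulr0 /rinner inner0r.
have X0 : 0 < rnorm x by rewrite lt_def rnorm_eq0 x0 rnorm_ge0.
have Y0 : 0 < rnorm y by rewrite lt_def rnorm_eq0 y0 rnorm_ge0.
have := TM (((rnorm x)^-1)%:C *: x) (((rnorm y)^-1)%:C *: y).
rewrite !rnormZ !rnorm_real !ger0_norm ?invr_ge0// !mulVf ?gt_eqF//.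
move=> /(_ (lexx _) (lexx _)); rewrite bopZ rinnerZl rinnerZr.
by rewrite !ler_pdivrMl// mulrA => h; rewrite mulrC (mulrC (rnorm x)).
Qed.

Lemma opnormD S T : opnorm (S + T) <= opnorm S + opnorm T.
Proof.
apply: opnorm_le => [|x]; first by rewrite addr_ge0 ?opnorm_ge0.
rewrite bopDE mulrDl; apply: le_trans (ler_rnormD _ _) _.
by rewrite lerD ?rnorm_le.
Qed.

Lemma opnormM S T : opnorm (S * T) <= opnorm S * opnorm T.
Proof.
apply: opnorm_le => [|x]; first by rewrite mulr_ge0 ?opnorm_ge0.
rewrite bopME; apply: le_trans (rnorm_le _ _) _.
by rewrite -mulrA ler_wpM2l ?opnorm_ge0 ?rnorm_le.
Qed.

Lemma opnormM_le S T (a b : R) : opnorm S <= a -> opnorm T <= b -> opnorm (S * T) <= a * b.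
Proof. by move=> Sa Tb; apply: le_trans (opnormM _ _) _; rewrite ler_pM ?opnorm_ge0. Qed.

Lemma opnormN T : opnorm (- T) = opnorm T.
Proof.
by congr sup; apply/seteqP; split=> _ [x /= x1 <-]; exists x => //=; rewrite normrN.
Qed.

Lemma opnorm_distC S T : opnorm (S - T) = opnorm (T - S).
Proof. by rewrite -opnormN opprB. Qed.

Lemma opnorm_distD S2 S T : opnorm (S - T) <= opnorm (S - S2) + opnorm (S2 - T).
Proof. by rewrite -[S - T](subrKA S2) opnormD. Qed.

Lemma opnorm0 : opnorm (0 : bop H) = 0.
Proof.
apply/eqP; rewrite eq_le opnorm_ge0 andbT.
by apply: opnorm_le => // x; rewrite bop0E rnorm0 mul0r.
Qed.

Lemma opnorm_le1 : opnorm (1 : bop H) <= 1.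
Proof. by apply: opnorm_le => // x; rewrite bop1E mul1r. Qed.

Lemma opnorm_prod_le n (F : 'I_n -> bop H) (M : R) :
  (forall i, opnorm (F i) <= M) -> opnorm (\prod_(i < n) F i) <= M ^+ n.
Proof.
elim: n F => [|n IH] F FM; first by rewrite big_ord0 opnorm_le1.
by rewrite big_ord_recl exprS opnormM_le// IH.
Qed.

Lemma opnormX_le1 T n : opnorm T <= 1 -> opnorm (T ^+ n) <= 1.
Proof.
move=> T1; elim: n => [|n IH]; first exact: opnorm_le1.
by rewrite exprS -[X in _ <= X]mulr1 opnormM_le.
Qed.

Lemma ler_opnorm_sum I (r : seq I) (P : pred I) (F : I -> bop H) :
  opnorm (\sum_(i <- r | P i) F i) <= \sum_(i <- r | P i) opnorm (F i).
Proof.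
elim/big_rec2: _ => [|i x y _ le]; first by rewrite opnorm0.
by apply: le_trans (opnormD _ _) _; rewrite lerD2l.
Qed.

Lemma opnormZ a T : opnorm (a *: T) <= rnorm a * opnorm T.
Proof.
apply: opnorm_le => [|x]; first by rewrite mulr_ge0 ?opnorm_ge0.
by rewrite bopZE rnormZ -mulrA ler_wpM2l// rnorm_le.
Qed.

End BoundedOperatorTheory.
#[global] Hint Extern 0 (is_true (0 <= opnorm _)) => solve [exact: opnorm_ge0] : core.

(** * Completeness of $H$ and of $B(H)$ *)

Section Completeness.
Context {R : realType} {H : hilbertType R}.

Lemma hilbert_complete (x : nat -> H) :
  (forall eps : R, 0 < eps -> exists n, forall k, (n <= k)%N -> rnorm (x k - x n) <= eps) ->
  exists l, forall eps : R, 0 < eps -> exists n, forall k, (n <= k)%N -> rnorm (x k - l) <= eps.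
Proof.
move=> xC; have : cvg (x @ \oo).
  apply/cauchy_cvgP/cauchy_exP => e e0.
  have eE : e = (complex.Re e)%:C by rewrite RRe_real ?gtr0_real.
  have {}e0 : 0 < complex.Re e by rewrite -ltcR -eE.
  have [n nP] := xC _ (divr_gt0 e0 (ltr0n R 2)).
  exists (x n), n => // k /= nk; rewrite eE -ball_normE /= rnormE ltcR rdistC.
  apply: le_lt_trans (nP k nk) _; lra.
move=> /cvg_ex[l xl]; exists l => eps e0.
move/cvgrPdist_le : xl => /(_ eps%:C); rewrite -[0]/(0%:C) ltcR => /(_ e0)[n _ nP].
by exists n => k /nP /=; rewrite rnormE lecR rdistC.
Qed.

(** The limit is taken pointwise; the Cauchy bound is uniform in the vector and passes to the limit,
    which gives boundedness of the limit and convergence in norm. *)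
Lemma bop_complete (T : nat -> bop H) :
  (forall eps : R, 0 < eps -> exists n, forall k, (n <= k)%N -> opnorm (T k - T n) <= eps) ->
  exists S, forall eps : R, 0 < eps -> exists n, forall k, (n <= k)%N -> opnorm (T k - S) <= eps.
Proof.
move=> TC.
have /choice[f fP] : forall x, exists l, forall eps : R, 0 < eps ->
    exists n, forall k, (n <= k)%N -> rnorm (T k x - l) <= eps.
  move=> x; apply: hilbert_complete => eps e0.
  have x0 : 0 < rnorm x + 1 by rewrite ltr_wpDl.
  have [n nP] := TC _ (divr_gt0 e0 x0); exists n => k nk.
  rewrite -bopBE; apply: le_trans (rnorm_le _ _) _.
  apply: (@le_trans _ _ (eps / (rnorm x + 1) * (rnorm x + 1))); last by rewrite divfK ?gt_eqF.
  by rewrite ler_pM ?nP// lerDl.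
have near_f x (p : nat) (eta : R) : 0 < eta -> exists2 k, (p <= k)%N & rnorm (T k x - f x) <= eta.
  by move=> /(fP x)[n nP]; exists (maxn p n); rewrite ?leq_maxl// nP ?leq_maxr.
have lf : linear f.
  move=> a x y; apply/eqP; rewrite -subr_eq0 -rnorm_eq0 eq_le rnorm_ge0 andbT.
  apply/ler_addgt0Pr => e e0; rewrite add0r.
  have e4 : 0 < e / 4 by lra.
  have a1 : 0 < rnorm a + 1 by rewrite ltr_wpDl.
  have [n1 P1] := fP (a *: x + y) _ e4.
  have [n2 P2] := fP x _ (divr_gt0 e4 a1).
  have [n3 P3] := fP y _ e4.
  pose k := maxn n1 (maxn n2 n3).
  have {}P1 := P1 k (leq_maxl _ _).
  have {}P2 : rnorm (a *: (T k x - f x)) <= e / 4.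
    rewrite rnormZ -[X in _ <= X](@divfK _ (rnorm a + 1)) ?gt_eqF// mulrC.
    by rewrite ler_pM// ?lerDl// P2// /k leq_max leq_max leqnn orbT.
  have {}P3 : rnorm (T k y - f y) <= e / 4 by rewrite P3// /k !leq_max leqnn !orbT.
  rewrite (_ : _ - _ = (a *: (T k x - f x) + (T k y - f y)) - (T k (a *: x + y) - f (a *: x + y))).
    apply: le_trans (ler_rnormB _ _) _.
    have := ler_rnormD (a *: (T k x - f x)) (T k y - f y); lra.
  by rewrite bop_linear scalerBr opprB [RHS]addrC (addrACA (a *: T k x)) -opprD subrKA.
have unif (eps : R) : 0 < eps -> exists n, forall k, (n <= k)%N ->
    forall x, rnorm (T k x - f x) <= eps * rnorm x.
  move=> e0; have e2 : 0 < eps / 2 by lra.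
  have [n nP] := TC _ e2; exists n => k nk x.
  (* The comparison index [p] depends on [x], but its error [eta] is arbitrary and disappears. *)
  apply/ler_addgt0Pr => eta eta0; have [p np pP] := near_f x n _ eta0.
  apply: le_trans (ler_rdistD (T p x) _ _) _; apply: lerD => //.
  apply: le_trans (ler_rdistD (T n x) _ _) _.
  rewrite [eps]splitr mulrDl; apply: lerD; rewrite -bopBE.
    by apply: le_trans (rnorm_le _ _) _; rewrite ler_wpM2r// nP.
  by apply: le_trans (rnorm_le _ _) _; rewrite opnorm_distC ler_wpM2r// nP.
have bf : f \in @bounded_op R H.
  have [n nP] := unif 1 ltr01.
  apply: (@bounded_opP _ _ _ (opnorm (T n) + 1) lf) => x.
  rewrite -[f x](subrK (T n x)) addrC mulrDl; apply: le_trans (ler_rnormD _ _) _.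
  by rewrite lerD ?rnorm_le// rdistC nP.
exists (Bop bf) => eps e0; have [n nP] := unif _ e0; exists n => k nk.
by apply: opnorm_le; [exact: ltW|exact: nP].
Qed.

End Completeness.

Section InverseSuccessor.
Context {R : realType}.

Lemma invSn_gt0 n : 0 < n.+1%:R^-1 :> R.
Proof. by rewrite invr_gt0 ltr0n. Qed.

Lemma ler_invSn n p : (n <= p)%N -> p.+1%:R^-1 <= n.+1%:R^-1 :> R.
Proof. by move=> np; rewrite lef_pV2 ?posrE ?ltr0n// ler_nat. Qed.

Lemma exists_invSn_le (e : R) : 0 < e -> exists n, n.+1%:R^-1 <= e.
Proof.
move=> e0; exists (truncn e^-1).
by rewrite -[leRHS]invrK lef_pV2 ?posrE ?ltr0n ?invr_gt0// ltW// real_truncnS_gt ?num_real.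
Qed.

End InverseSuccessor.

(** * Riesz representation and adjoints *)

Section Riesz.
Context {R : realType} {H : hilbertType R}.

(* The representing vector minimises [rnorm x ^+ 2 - phi x *+ 2]: minimising
   sequences are Cauchy by the parallelogram law. *)
Lemma riesz (phi : H -> R) (M : R) :
  (forall x y, phi (x + y) = phi x + phi y) ->
  (forall t x, phi (t%:C *: x) = t * phi x) ->
  (forall x, phi x <= M * rnorm x) ->
  exists z, forall x, phi x = rinner x z.
Proof.
move=> phiD phiZ phiM; pose J x := rnorm x ^+ 2 - phi x *+ 2.
pose m := inf (range J).
have infJ : has_inf (range J).
  split; first by exists (J 0), 0.
  exists (- M ^+ 2) => _ [x _ <-]; rewrite /J.
  have := phiM x; have := sqr_ge0 (rnorm x - M); nra.
have mJ x : m <= J x by apply: ge_inf; [case: infJ|exists x].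
have /choice[x xJ] : forall n : nat, exists x, J x < m + n.+1%:R^-1.
  move=> n; have [_ [x _ <-]] := inf_adherent (invSn_gt0 n) infJ.
  by exists x.
(* The parallelogram law; the linear part of [J] cancels. *)
have Jmid u v : rnorm (u - v) ^+ 2 = J u *+ 2 + J v *+ 2 - J ((2^-1)%:C *: (u + v)) *+ 4.
  rewrite /J rnormB_sqr phiZ phiD rnormZ rnorm_real exprMn real_normK ?num_real//.
  by rewrite rnormD_sqr; field.
have [z zP] : exists z, forall eps : R, 0 < eps ->
    exists n, forall k, (n <= k)%N -> rnorm (x k - z) <= eps.
  apply: hilbert_complete => eps e0.
  (* Both values of [J] lie within [n.+1%:R^-1] of the infimum, so [Jmid] bounds the squared
     distance by four times that. *)
  have [n nP] := exists_invSn_le (divr_gt0 (exprn_gt0 2 e0) (ltr0n R 4)).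
  exists n => k nk; rewrite -(@ler_pXn2r _ 2) ?nnegrE//; last exact: ltW.
  rewrite Jmid; have := mJ ((2^-1)%:C *: (x k + x n)).
  have := xJ k; have := xJ n.
  have : k.+1%:R^-1 <= n.+1%:R^-1 :> R by exact: ler_invSn.
  clear mJ infJ; clearbody m; move: nP; move: (J (x k)) (J (x n)) (J _) => a b c.
  move: (k.+1%:R^-1) (n.+1%:R^-1) => p q; lra.
exists z => y; pose c := rinner y z - phi y; pose q := rnorm y ^+ 2.
have q0 : 0 <= q by exact: sqr_ge0.
(* This is $J(z+ty)-J(z)\ge 0$, obtained by passing to the limit along the minimising sequence. *)
have ct t : 0 <= t * c *+ 2 + t ^+ 2 * q.
  apply/ler_addgt0Pr => e e0.
  pose d := `|t| * rnorm y *+ 2 + 1.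
  have d0 : 0 < d by rewrite ltr_wpDl// mulrn_wge0// mulr_ge0.
  have e2 : 0 < e / 2 by lra.
  have [n nP] := zP _ (divr_gt0 e2 d0).
  have [p pP] := exists_invSn_le e2.
  pose k := maxn n p; have {}nP := nP k (leq_maxl _ _).
  have kP : k.+1%:R^-1 <= e / 2.
    by apply: le_trans pP; rewrite ler_invSn// leq_maxr.
  have h1 := mJ (x k + t%:C *: y); have h2 := xJ k.
  rewrite /J rnormD_sqr rinnerZr phiD phiZ rnormZ rnorm_real exprMn real_normK ?num_real// in h1.
  rewrite /J in h2.
  have : t * (rinner (x k) y - rinner z y) *+ 2 <= e / 2.
    rewrite -rinnerNl -rinnerDl.
    apply: (@le_trans _ _ (rnorm (x k - z) * d)); last by rewrite -ler_pdivlMr.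
    apply: (@le_trans _ _ (rnorm (x k - z) * (`|t| * rnorm y *+ 2))).
      rewrite mulrnAr lerMn2r/= (le_trans (ler_norm _))// normrM.
      by rewrite mulrCA ler_wpM2l// rinner_le.
    by rewrite ler_wpM2l// lerDl.
  rewrite /c /q (rinnerC y z); move: h1 h2 kP; move: (k.+1%:R^-1) (rinner (x k) y) (rinner z y).
  clear mJ infJ; clearbody m; move: (rnorm (x k)) (rnorm y) (phi (x k)) (phi y) (e : R) => *; lra.
(* The exact minimiser would be [- c / q]; [q + 1] avoids a division by zero, and the value is still
   a negative multiple of [c ^+ 2]. *)
have := ct (- c / (q + 1)).
have q1 : 0 < q + 1 by rewrite ltr_wpDl.
rewrite [X in 0 <= X](_ : _ = - (c ^+ 2 * (q + 2)) / (q + 1) ^+ 2); last first.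
  by field; rewrite gt_eqF.
rewrite mulNr oppr_ge0 pmulr_lle0 ?invr_gt0 ?exprn_gt0// => h.
have : c ^+ 2 <= 0 by have := sqr_ge0 c; nra.
by rewrite le_eqVlt ltNge sqr_ge0 orbF sqrf_eq0 /c subr_eq0 => /eqP.
Qed.

Lemma ex_adjoint (T : bop H) : exists S, is_adjoint T S.
Proof.
have /choice[g gP] : forall y, exists z, forall x, rinner (T x) y = rinner x z.
  move=> y; apply: (@riesz _ (opnorm T * rnorm y)) => [x x'|t x|x].
  - by rewrite bopD rinnerDl.
  - by rewrite bopZ rinnerZl.
  - apply: le_trans (ler_norm _) _; apply: le_trans (rinner_le _ _) _.
    by rewrite mulrAC ler_wpM2r// rnorm_le.
have gi x y : inner (T x) y = inner x (g y).
  apply/eqP; rewrite eq_complex; apply/andP; split; first exact/eqP/gP.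
  (* The choice of [g] gives equality of the real parts only; the vector $ix$ gives that of the
     imaginary parts. *)
  have /eqP := gP y ('i%C *: x); rewrite bopZ /rinner !innerZl.
  by case: (inner (T x) y) (inner x (g y)) => a b [c d] /=; rewrite !mul0r !mul1r !sub0r eqr_opp.
have lg : linear g.
  move=> a y z; apply: inner_inj => x; rewrite rinnerC [RHS]rinnerC /rinner.
  by rewrite -gi innerDr innerZr !gi innerDr innerZr.
have gb : g \in @bounded_op R H.
  apply: (@bounded_opP _ _ _ (opnorm T) lg) => y.
  have [->|g0] := eqVneq (rnorm (g y)) 0; first by rewrite mulr_ge0.
  have G0 : 0 < rnorm (g y) by rewrite lt_def g0 rnorm_ge0.
  rewrite -(ler_pM2l G0) -expr2 -rinnerxx -gP.
  apply: le_trans (ler_norm _) _; apply: le_trans (rinner_le _ _) _.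
  by rewrite mulrA ler_wpM2r// mulrC rnorm_le.
by exists (Bop gb).
Qed.

Lemma innerTl (T : bop H) x y : inner (T x) y = inner x (adjoint T y).
Proof. by have := xgetPex 0 (ex_adjoint T); apply. Qed.

Lemma innerTr (T : bop H) x y : inner x (T y) = inner (adjoint T x) y.
Proof. by rewrite innerC innerTl -innerC. Qed.

Lemma rinnerTr (T : bop H) x y : rinner x (T y) = rinner (adjoint T x) y.
Proof. by rewrite /rinner innerTr. Qed.

Lemma opnorm_adjoint_le (T : bop H) : opnorm (adjoint T) <= opnorm T.
Proof.
apply: opnorm_le_rinner => // x y; rewrite -rinnerTr.
apply: le_trans (ler_norm _) _; apply: le_trans (rinner_le _ _) _.
by rewrite mulrCA ler_wpM2l// rnorm_le.
Qed.

End Riesz.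

Lemma rnormi (R : realType) : rnorm ('i%C : R[i]) = 1.
Proof.
by apply/eqP; rewrite -(@eqrXn2 _ 2)// rnorm_sqr /= expr0n add0r.
Qed.

(** * Compact operators *)

Section CompactOperators.
Context {R : realType} {H : hilbertType R}.
Implicit Types (S T : bop H) (x y : H).

Lemma nbhs_rball x (eps : R) : 0 < eps -> nbhs x [set y | rnorm (x - y) < eps].
Proof.
move=> e0; apply/nbhs_ballP; exists eps%:C; first by rewrite /= -[0]/(0%:C) ltcR.
by move=> y; rewrite -ball_normE /= rnormE ltcR.
Qed.

(** The closure of the image of the unit ball is complete, so compactness is total boundedness: at
    every scale an ultrafilter on it contains one of finitely many balls, hence is Cauchy. *)
Lemma compact_opP T : compact_op T <-> forall eps : R, 0 < eps ->
  exists s : seq H, forall x, rnorm x <= 1 -> exists2 f, f \in s & rnorm (T x - f) <= eps.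
Proof.
have ball1 x : `|x| <= 1 <-> rnorm x <= 1 by rewrite rnormE -[1]/(1%:C) lecR.
split=> [|tb].
  rewrite /compact_op /= compact_cover => cT eps e0.
  have [||D _ sD] := cT H setT (fun f => [set y | rnorm (f - y) < eps]).
  - move=> f _; rewrite openE => y /= fy; rewrite /interior.
    have d0 : 0 < eps - rnorm (f - y) by rewrite subr_gt0.
    apply: filterS (nbhs_rball y d0) => z /= yz.
    by apply: le_lt_trans (ler_rdistD y _ _) _; rewrite addrC -ltrBrDr.
  - by move=> y _; exists y => //=; rewrite subrr rnorm0.
  exists (enum_fset D) => x x1.
  have [f fD /= fx] : cover [set` D] (fun f => [set y | rnorm (f - y) < eps]) (T x).
    by apply: sD; apply: subset_closure; exists x => //=; apply/ball1.
  by exists f => //; rewrite rdistC ltW.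
rewrite /compact_op /= compact_ultra => F UF FA.
have cov (eps : R) : 0 < eps -> exists y, F [set z | rnorm (y - z) < eps].
  move=> e0; have e2 : 0 < eps / 2 by lra.
  have [s sP] := tb _ e2.
  pose B y := [set z : H | rnorm (y - z) < eps].
  have : F (\bigcup_(f in [set` s]) B f).
    apply: filterS FA => z /(_ _ (nbhs_rball z e2)) [_ [[x /= /ball1 x1 <-] /= zx]].
    have [f fs fx] := sP x x1; exists f => //; rewrite /B /=.
    apply: le_lt_trans (ler_rdistD (T x) _ _) _.
    rewrite (rdistC f) (rdistC _ z); lra.
  elim: s {sP} => [|f s IH].
    move=> FB; exfalso; apply: (@filter_not_empty _ F); apply: filterS FB.
    by move=> z [].
  move=> FB; have [|/(filterI FB) FC] := in_ultra_setVsetC (B f) UF; first by exists f.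
  apply: IH; apply: filterS FC => z [[g /=]]; rewrite inE => /orP[/eqP->|gs] gz ngz //.
  by exists g.
have : cvg F.
  apply/cauchy_cvgP/cauchy_exP => e e0.
  have eE : e = (complex.Re e)%:C by rewrite RRe_real ?gtr0_real.
  have {}e0 : 0 < complex.Re e by rewrite -ltcR -eE.
  have [y Fy] := cov _ e0; exists y; apply: filterS Fy => z /=.
  by rewrite eE -ball_normE /= rnormE ltcR.
move=> /cvg_ex[p Fp]; exists p; split=> //.
by apply: (@closed_closure _ _ p) => B /Fp FB; exact: filter_ex (filterI FA FB).
Qed.

Lemma compact_op_approx T :
  (forall eps : R, 0 < eps -> exists2 S, compact_op S & opnorm (T - S) <= eps) -> compact_op T.
Proof.
move=> TS; apply/compact_opP => eps e0; have e2 : 0 < eps / 2 by lra.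
have [S /compact_opP/(_ _ e2)[s sP] TSe] := TS _ e2.
exists s => x x1; have [f fs fx] := sP x x1; exists f => //.
apply: le_trans (ler_rdistD (S x) _ _) _; rewrite [eps]splitr lerD// -bopBE.
exact: le_trans (rnorm_le1 _ x1) _.
Qed.

Lemma compact_op0 : compact_op (0 : bop H).
Proof.
apply/compact_opP => eps e0; exists [:: 0] => x _.
by exists 0; rewrite ?mem_head// bop0E subrr rnorm0 ltW.
Qed.

Lemma compact_opD S T : compact_op S -> compact_op T -> compact_op (S + T).
Proof.
move=> /compact_opP cS /compact_opP cT; apply/compact_opP => eps e0.
have e2 : 0 < eps / 2 by lra.
have [s sP] := cS _ e2; have [t tP] := cT _ e2.
exists [seq f + g | f <- s, g <- t] => x x1.
have [f fs fx] := sP x x1; have [g gt gx] := tP x x1.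
exists (f + g); first exact: allpairs_f.
by rewrite bopDE opprD addrACA (le_trans (ler_rnormD _ _))// [eps]splitr lerD.
Qed.

Lemma compact_op_sum I (r : seq I) (P : pred I) (F : I -> bop H) :
  (forall i, P i -> compact_op (F i)) -> compact_op (\sum_(i <- r | P i) F i).
Proof. by move=> cF; elim/big_ind: _; [exact: compact_op0|exact: compact_opD|]. Qed.

Lemma compact_opMl S T : compact_op T -> compact_op (S * T).
Proof.
move=> /compact_opP cT; apply/compact_opP => eps e0.
have S1 : 0 < opnorm S + 1 by rewrite ltr_wpDl.
have [s sP] := cT _ (divr_gt0 e0 S1); exists (map S s) => x x1.
have [f fs fx] := sP x x1; exists (S f); first exact: map_f.
rewrite bopME -bopB; apply: le_trans (rnorm_le _ _) _.
rewrite -[leRHS](@divfK _ (opnorm S + 1)) ?gt_eqF// mulrC.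
by rewrite ler_pM// lerDl.
Qed.

(** Since [S] takes the unit ball into the ball of radius [c], a net for [T] is taken at scale
    [eps / c] and dilated by [c]. *)
Lemma compact_opMr S T : compact_op T -> compact_op (T * S).
Proof.
move=> /compact_opP cT; apply/compact_opP => eps e0.
pose c := opnorm S + 1; have c0 : 0 < c by rewrite ltr_wpDl.
have [s sP] := cT _ (divr_gt0 e0 c0); exists [seq c%:C *: f | f <- s] => x x1.
have [|f fs fx] := sP ((c^-1)%:C *: S x).
  rewrite rnormZ rnorm_real gtr0_norm ?invr_gt0// ler_pdivrMl// mulr1.
  by apply: le_trans (rnorm_le1 _ x1) _; rewrite lerDl.
exists (c%:C *: f); first exact: map_f.
rewrite bopME (_ : T (S x) = c%:C *: T ((c^-1)%:C *: S x)); last first.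
  by rewrite bopZ scalerA -rmorphM divff ?gt_eqF// scale1r.
by rewrite -scalerBr rnormZ rnorm_real gtr0_norm// mulrC -ler_pdivlMr.
Qed.

Lemma compact_opN T : compact_op T -> compact_op (- T).
Proof. by move=> cT; rewrite -mulN1r; exact: compact_opMl. Qed.

Lemma rk_subproof u v : (fun x : H => inner x v *: u) \in @bounded_op R H.
Proof.
apply: (@bounded_opP _ _ _ (rnorm v * rnorm u)) => [a x y|x].
  by rewrite innerDl innerZl scalerDl scalerA.
rewrite rnormZ mulrAC ler_wpM2r// mulrC; exact: inner_le.
Qed.

(** The rank-one operator $u\otimes v^*$, conjugate-linear in [v]. *)
Definition rk u v : bop H := Bop (rk_subproof u v).

Lemma rkE u v x : rk u v x = inner x v *: u. Proof. by []. Qed.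

Lemma opnorm_rk u v : opnorm (rk u v) <= rnorm u * rnorm v.
Proof.
apply: opnorm_le => [|x]; first by rewrite mulr_ge0.
by rewrite rkE rnormZ mulrC -mulrA ler_wpM2l// mulrC inner_le.
Qed.

Lemma interval_net (M eps : R) : 0 < eps ->
  exists s : seq R, forall a, `|a| <= M -> exists2 t, t \in s & `|a - t| <= eps.
Proof.
move=> e0; exists [seq k%:R * eps - M | k <- iota 0 (truncn ((M + M) / eps)).+1] => a aM.
have [aM1 aM2] : 0 <= a + M /\ a <= M by move: aM; rewrite ler_norml; lra.
have q0 : 0 <= (a + M) / eps by rewrite divr_ge0// ltW.
exists ((truncn ((a + M) / eps))%:R * eps - M).
  apply: (map_f (fun k : nat => k%:R * eps - M)); rewrite mem_iota /= add0n ltnS.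
  by apply: le_truncn; rewrite ler_pM2r ?invr_gt0// lerD2r.
have /andP[] := truncn_itv q0.
rewrite ler_pdivlMr// ltr_pdivrMr// -natr1 => h1 h2.
by rewrite ler_norml; apply/andP; split; lra.
Qed.

(** The values on the unit ball are multiples of [u] by scalars of modulus at most [rnorm v]. A grid
    for their real and imaginary parts gives the net, and [d] leaves half of [eps] to each part. *)
Lemma compact_rk u v : compact_op (rk u v).
Proof.
apply/compact_opP => eps e0; pose d := eps / (2 * (rnorm u + 1)).
have u1 : 0 < rnorm u + 1 by rewrite ltr_wpDl.
have d0 : 0 < d by rewrite divr_gt0// mulr_gt0.
have [s sP] := interval_net (rnorm v) d0.
exists [seq (a +i* b) *: u | a <- s, b <- s] => x x1.
have cv : rnorm (inner x v) <= rnorm v.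
  by apply: le_trans (inner_le _ _) _; rewrite ler_piMl.
rewrite rkE; case: (inner x v) cv => p q cv.
have [a sa pa] := sP p (le_trans (ler_rnormRe (p +i* q)) cv).
(* The imaginary part of a number is bounded through the real part of its product with $i$. *)
have [b sb qb] : exists2 t, t \in s & `|q - t| <= d.
  apply: sP; apply: le_trans cv; have := ler_rnormRe ('i%C * (p +i* q)).
  by rewrite rnormM /= mul0r mul1r sub0r normrN => /le_trans; apply; rewrite rnormi mul1r.
exists ((a +i* b) *: u); first exact: allpairs_f.
rewrite -scalerBl rnormZ; apply: (@le_trans _ _ (d *+ 2 * (rnorm u + 1))).
  rewrite ler_pM ?lerDl// (_ : _ - _ = (p - a)%:C + 'i%C * (q - b)%:C); last first.
    by apply/eqP; rewrite eq_complex /= !(mul0r, mul1r, subr0, addr0, add0r) !eqxx.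
  apply: le_trans (ler_rnormD _ _) _; rewrite rnormM !rnorm_real mulr2n lerD//.
  by rewrite rnormi mul1r.
by rewrite /d le_eqVlt; apply/orP; left; apply/eqP; field; rewrite gt_eqF.
Qed.

End CompactOperators.

(** * Basis projections and a countable dense family of compact operators *)

Section OrthonormalBasis.
Context {R : realType} {H : hilbertType R} (e : int -> H).
Hypothesis he : orthonormal_basis e.
Implicit Types (x y : H) (m : nat).

Lemma inner_onb i j : inner (e i) (e j) = (i == j)%:R.
Proof. by case: he => h _; exact: h. Qed.

Lemma rnorm_onb i : rnorm (e i) = 1.
Proof.
by apply/eqP; rewrite -(@eqrXn2 _ 2)// -rinnerxx /rinner inner_onb eqxx expr1n.
Qed.

Lemma onb_dense x (eps : R) : 0 < eps -> exists m y, Lspan e m y /\ rnorm (x - y) <= eps.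
Proof.
move=> e0; case: he => _ /(_ (interior [set y | rnorm (x - y) < eps])).
case=> [||y [/interior_subset /= xy [m _ my]]].
- by exists x; exact: nbhs_rball.
- exact: open_interior.
- by exists m, y; split=> //; exact: ltW.
Qed.

(** An explicit sum of rank-one projections, convenient for computation; [orthoproj_Lspan]
    identifies it with $P_m$. *)
Definition lproj m : bop H :=
  \sum_(i < m.*2.+1) rk (e (i%:Z - m%:Z)) (e (i%:Z - m%:Z)).

Lemma lprojE m x : lproj m x =
  \sum_(i < m.*2.+1) inner x (e (i%:Z - m%:Z)) *: e (i%:Z - m%:Z).
Proof. by rewrite bop_sumE. Qed.

Lemma Lspan_lproj m x : Lspan e m (lproj m x).
Proof. by exists (fun i => inner x (e (i%:Z - m%:Z))); rewrite lprojE. Qed.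

Lemma inner_sub_lproj m x (i : 'I_m.*2.+1) :
  inner (x - lproj m x) (e (i%:Z - m%:Z)) = 0.
Proof.
rewrite innerBl lprojE inner_suml (bigD1 i)//= innerZl inner_onb eqxx mulr1.
rewrite big1 ?addr0 ?subrr// => j ji; rewrite innerZl inner_onb (inj_eq (addIr _)).
by rewrite eqz_nat val_eqE (negPf ji) mulr0.
Qed.

Lemma is_orthoproj_lproj m : is_orthoproj (Lspan e m) (lproj m).
Proof.
split=> [x|x _ y /= -> [c ->]]; first exact: Lspan_lproj.
by rewrite inner_sumr big1// => i _; rewrite innerZr inner_sub_lproj mulr0.
Qed.

Lemma sub_lproj_perp m x y : Lspan e m y -> inner (x - lproj m x) y = 0.
Proof. by move=> my; have [_ /(_ x)] := is_orthoproj_lproj m; apply. Qed.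

(** The difference of two orthogonal projections of [x] lies in $L_m$ and is orthogonal to it. *)
Lemma orthoproj_Lspan m : orthoproj (Lspan e m) = lproj m.
Proof.
have [QL Qperp] := xgetPex 0 (ex_intro _ _ (is_orthoproj_lproj m)).
rewrite -/(orthoproj _) in QL Qperp; set Q := orthoproj _ in QL Qperp *.
apply: bop_eq => x; apply: inner_inj => z; congr complex.Re.
apply/eqP; rewrite -subr_eq0 -innerBl.
have QP y : Lspan e m y -> inner (Q x - lproj m x) y = 0.
  move=> my; rewrite -[_ - _](subrKA x) innerDl sub_lproj_perp// addr0.
  by rewrite -opprB innerNl (Qperp x _ _ _ my) ?oppr0.
suff -> : Q x - lproj m x = 0 by rewrite inner0l.
apply/eqP; rewrite -rnorm_eq0 -sqrf_eq0 -rinnerxx /rinner innerBr.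
by rewrite !QP ?subrr//; exact: Lspan_lproj.
Qed.

Lemma lproj_pythagoras m x : rnorm x ^+ 2 = rnorm (lproj m x) ^+ 2 + rnorm (x - lproj m x) ^+ 2.
Proof.
rewrite -{1}(subrK (lproj m x) x) (rnormD_sqr (x - _)) /rinner sub_lproj_perp; last exact: Lspan_lproj.
by rewrite mul0rn addr0 addrC.
Qed.

Lemma rnorm_sub_lproj m x : rnorm (x - lproj m x) <= rnorm x.
Proof.
by rewrite -(@ler_pXn2r _ 2) ?nnegrE// (lproj_pythagoras m x) lerDr sqr_ge0.
Qed.

Lemma compact_lproj m : compact_op (lproj m).
Proof. by apply: compact_op_sum => i _; exact: compact_rk. Qed.

Lemma lproj_id m y : Lspan e m y -> lproj m y = y.
Proof.
move=> my; apply/esym/eqP; rewrite -subr_eq0 -rnorm_eq0 -sqrf_eq0 -rinnerxx /rinner innerBr.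
by rewrite !sub_lproj_perp ?subrr//; exact: Lspan_lproj.
Qed.

Lemma Lspan_onb m (i : int) : (`|i| <= m)%N -> Lspan e m (e i).
Proof.
move=> im; have k0 : (`|(i + m%:Z)%R| < m.*2.+1)%N by lia.
pose k := Ordinal k0; exists (fun j => (j == k)%:R); rewrite (bigD1 k)//= eqxx scale1r.
rewrite big1 ?addr0 => [|j /negPf->]; last by rewrite scale0r.
by congr e; lia.
Qed.

Lemma lproj_onb m (i : int) : (`|i| <= m)%N -> lproj m (e i) = e i.
Proof. by move=> im; rewrite lproj_id//; exact: Lspan_onb. Qed.

Lemma Lspan_mono m p : (m <= p)%N -> Lspan e m `<=` Lspan e p.
Proof.
move=> mp _ [c ->]; set y := \sum_(i < _) _.
have <- : lproj p y = y; last exact: Lspan_lproj.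
rewrite bop_sum; apply: eq_bigr => i _; rewrite bopZ lproj_onb//.
by have := ltn_ord i; lia.
Qed.

Lemma lproj_best m x y : Lspan e m y -> rnorm (x - lproj m x) <= rnorm (x - y).
Proof.
move=> my; apply: le_trans (rnorm_sub_lproj m (x - y)).
by rewrite bopB (lproj_id my) opprB addrA subrK.
Qed.

(** A finite net approximates the image of the unit ball, so one [m] serves for all of it;
    [lproj_best] passes from the approximants to the projection. *)
Lemma lproj_compact K (eps : R) : compact_op K -> 0 < eps ->
  exists m, opnorm (K - lproj m * K) <= eps.
Proof.
move=> /compact_opP cK e0; have e2 : 0 < eps / 2 by lra.
have [s sP] := cK _ e2.
have [m mP] : exists m, forall f, f \in s -> exists2 y, Lspan e m y & rnorm (f - y) <= eps / 2.
  elim: s {sP} => [|f s [m mP]]; first by exists 0%N.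
  have [p [y [py fy]]] := onb_dense f e2; exists (maxn m p) => g.
  rewrite inE => /orP[/eqP->|/mP[z mz gz]].
    by exists y => //; apply: Lspan_mono py; exact: leq_maxr.
  by exists z => //; apply: Lspan_mono mz; exact: leq_maxl.
exists m; apply: opnorm_le_ball => x x1; rewrite bopBE bopME.
have [f /mP[y my fy] fx] := sP x x1.
apply: le_trans (lproj_best _ my) _; apply: le_trans (ler_rdistD f _ _) _.
by rewrite [eps]splitr lerD.
Qed.

Definition ratC (c : rat * rat) : R[i] := ratr c.1 +i* ratr c.2.

(** Finite-rank operators with complex rational matrix entries. The argument ranges over a countable
    type, which later allows an enumeration of targets. *)
Definition ratop (s : seq (int * int * (rat * rat))) : bop H :=
  \sum_(c <- s) ratC c.2 *: rk (e c.1.1) (e c.1.2).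

Lemma ratr_dense (x eps : R) : 0 < eps -> exists q, `|x - ratr q| <= eps.
Proof.
move=> e0; have [|q] := @rat_in_itvoo R (x - eps) (x + eps); first by lra.
by rewrite in_itv /= => /andP[q1 q2]; exists q; rewrite ler_norml; apply/andP; split; lra.
Qed.

Lemma ratC_dense (c : R[i]) (eps : R) : 0 < eps -> exists q, rnorm (c - ratC q) <= eps.
Proof.
case: c => a b e0; have e2 : 0 < eps / 2 by lra.
have [p pP] := ratr_dense a e2; have [q qP] := ratr_dense b e2.
exists (p, q); rewrite /ratC /=.
rewrite (_ : _ - _ = (a - ratr p)%:C + 'i%C * (b - ratr q)%:C); last first.
  by apply/eqP; rewrite eq_complex /= !(mul0r, mul1r, subr0, addr0, add0r) !eqxx.
apply: le_trans (ler_rnormD _ _) _.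
by rewrite rnormM !rnorm_real rnormi mul1r [eps]splitr lerD.
Qed.

Lemma compact_ratop s : compact_op (ratop s).
Proof.
apply: compact_op_sum => c _; set T := rk _ _.
have -> : ratC c.2 *: T = (ratC c.2 *: (1 : bop H)) * T by exact: bop_eq.
exact/compact_opMl/compact_rk.
Qed.

(** The class [D] of approximable operators is closed under finite sums and norm limits; it is shown
    to contain $e_a\otimes e_b^*$, then $e_a\otimes v^*$, then [lproj m * K], then [K]. *)
Lemma ratop_dense K (eps : R) : compact_op K -> 0 < eps ->
  exists s, opnorm (K - ratop s) <= eps.
Proof.
pose D : set (bop H) := [set T | forall eps : R, 0 < eps -> exists s, opnorm (T - ratop s) <= eps].
have Dapprox T : (forall d : R, 0 < d -> exists2 S, D S & opnorm (T - S) <= d) -> D T.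
  move=> TS d d0; have d2 : 0 < d / 2 by lra.
  have [S /(_ _ d2)[s sP] SP] := TS _ d2; exists s.
  by apply: le_trans (opnorm_distD S _ _) _; rewrite [d]splitr lerD.
have Dsum I (r : seq I) (P : pred I) F : (forall i, P i -> D (F i)) -> D (\sum_(i <- r | P i) F i).
  move=> DF; elim/big_ind: _ => //.
  - by move=> d d0; exists [::]; rewrite /ratop big_nil subrr opnorm0 ltW.
  - move=> S T DS DT d d0; have d2 : 0 < d / 2 by lra.
    have [s sP] := DS _ d2; have [t tP] := DT _ d2; exists (s ++ t).
    rewrite /ratop big_cat /= opprD addrACA; apply: le_trans (opnormD _ _) _.
    by rewrite [d]splitr lerD.
have Drk1 (c : R[i]) a b : D (c *: rk (e a) (e b)).
  move=> d d0; have [q qP] := ratC_dense c d0; exists [:: ((a, b), q)].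
  rewrite /ratop big_seq1 /= -scalerBl; apply: le_trans (opnormZ _ _) _.
  apply: le_trans qP; rewrite ler_piMr//; apply: le_trans (opnorm_rk _ _) _.
  by rewrite !rnorm_onb mul1r.
have Drk a v : D (rk (e a) v).
  apply: Dapprox => d d0; have [m [_ [[c ->] cP]]] := onb_dense v d0.
  exists (rk (e a) (\sum_(i < m.*2.+1) c i *: e (i%:Z - m%:Z))).
    rewrite (_ : rk _ _ = \sum_(i < m.*2.+1) (c i)^*%C *: rk (e a) (e (i%:Z - m%:Z))).
      exact: Dsum.
    apply: bop_eq => x; rewrite rkE bop_sumE inner_sumr scaler_suml.
    by apply: eq_bigr => i _; rewrite innerZr bopZE rkE scalerA.
  apply: opnorm_le => [|x]; first exact: ltW.
  rewrite bopBE !rkE -scalerBl -innerBr rnormZ rnorm_onb mulr1 mulrC.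
  by apply: le_trans (inner_le _ _) _; rewrite ler_wpM2l.
move=> cK e0; suff : D K by apply.
apply: Dapprox => d d0; have [m mP] := lproj_compact cK d0.
exists (lproj m * K) => //.
rewrite (_ : lproj m * K = \sum_(i < m.*2.+1) rk (e (i%:Z - m%:Z)) (adjoint K (e (i%:Z - m%:Z)))).
  by apply: Dsum => i _; exact: Drk.
by apply: bop_eq => x; rewrite bopME lprojE bop_sumE; apply: eq_bigr => i _; rewrite rkE innerTl.
Qed.

End OrthonormalBasis.

(* The standard module in terms of scalar square sums *)
#[local] Existing Instance totally_filter.

Section StandardModule.
Context {R : realType} {H : hilbertType R}.
Implicit Types (x y : int -> bop H) (s : seq int) (F : {fset int}).

Definition gram x s : bop H := \sum_(j <- s) adjoint (x j) * x j.

Lemma partial_sumE x F : partial_sum (fun j => adjoint (x j) * x j) F = gram x F.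
Proof. by rewrite /partial_sum /gram big_seq_fsetE. Qed.

Lemma rinner_gram x s v w : rinner (gram x s v) w = \sum_(j <- s) rinner (x j v) (x j w).
Proof.
rewrite /gram bop_sumE rinner_suml; apply: eq_bigr => j _.
by rewrite bopME -rinnerTr.
Qed.

Lemma rinner_gram_sqr x s v : rinner (gram x s v) v = \sum_(j <- s) rnorm (x j v) ^+ 2.
Proof. by rewrite rinner_gram; apply: eq_bigr => j _; rewrite rinnerxx. Qed.

(** Gram operators are positive, so their quadratic form controls the norm: each mixed term is at
    most the mean of the two squares. *)
Lemma opnorm_gram x s (c : R) : 0 <= c ->
  (forall v, rnorm v <= 1 -> \sum_(j <- s) rnorm (x j v) ^+ 2 <= c) -> opnorm (gram x s) <= c.
Proof.
move=> c0 xc; apply: opnorm_le_rinner1 => // v w v1 w1; rewrite rinner_gram.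
apply: (@le_trans _ _ (\sum_(j <- s) (rnorm (x j v) ^+ 2 + rnorm (x j w) ^+ 2) / 2)).
  apply: ler_sum => j _; apply: le_trans (ler_norm _) _; apply: le_trans (rinner_le _ _) _.
  have := sqr_ge0 (rnorm (x j v) - rnorm (x j w)); nra.
rewrite -mulr_suml big_split /=; have := xc v v1; have := xc w w1; lra.
Qed.

Lemma sum_subset (f : int -> R) s t : uniq s -> uniq t -> {subset s <= t} ->
  (forall j, 0 <= f j) -> \sum_(j <- s) f j <= \sum_(j <- t) f j.
Proof.
move=> us ut st f0.
have /(perm_big _)-> : perm_eq t (s ++ [seq j <- t | j \notin s]).
  apply: uniq_perm => //; first rewrite cat_uniq us filter_uniq// andbT /=.
    by apply/hasPn => j; rewrite mem_filter => /andP[].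
  move=> j; rewrite mem_cat mem_filter; case: (boolP (j \in s)) => //= js.
  by rewrite st.
by rewrite big_cat /= lerDl sumr_ge0.
Qed.

Lemma gram_cat x s t : gram x (s ++ t) = gram x s + gram x t.
Proof. exact: big_cat. Qed.

Lemma gram_sub x F G : (G `<=` F)%fset ->
  gram x F - gram x G = gram x [seq j <- F | j \notin G].
Proof.
move=> GF; apply/eqP; rewrite subr_eq addrC -gram_cat; apply/eqP/perm_big.
apply: uniq_perm; first exact: fset_uniq.
  rewrite cat_uniq filter_uniq ?fset_uniq// andbT /=.
  by apply/hasPn => j; rewrite mem_filter => /andP[].
move=> j; rewrite mem_cat mem_filter; case: (boolP (j \in G)) => //= jG.
by rewrite (fsubsetP GF).
Qed.

(** With [l2tail], this expresses the norm and the convergence of the operator sum by scalar sums,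
    uniformly over the unit ball. *)
Definition l2le x (M : R) := forall s, uniq s -> forall v, rnorm v <= 1 ->
  \sum_(j <- s) rnorm (x j v) ^+ 2 <= M ^+ 2.

Definition l2tail x := forall eps : R, 0 < eps -> exists F, forall s, uniq s ->
  (forall j, j \in s -> j \notin F) -> forall v, rnorm v <= 1 ->
  \sum_(j <- s) rnorm (x j v) ^+ 2 <= eps.

Lemma l2_sum_cvg x S : l2_sum x S -> forall eps : R, 0 < eps ->
  exists A, forall F, (A `<=` F)%fset -> opnorm (gram x F - S) <= eps.
Proof.
move=> [_ /cvgrPdist_le cv] eps /cv [A _ AP]; exists A => F /AP /=.
by rewrite sub0r normrN partial_sumE ger0_norm.
Qed.

Lemma l2_sum_le x S : l2_sum x S -> forall s, uniq s -> forall v, rnorm v <= 1 ->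
  \sum_(j <- s) rnorm (x j v) ^+ 2 <= opnorm S.
Proof.
move=> xS s us v v1; apply/ler_addgt0Pr => eps e0.
have [A AP] := l2_sum_cvg xS e0.
pose F := (A `|` [fset j in s])%fset.
apply: (@le_trans _ _ (\sum_(j <- F) rnorm (x j v) ^+ 2)).
  apply: sum_subset => // [|j js|j]; [exact: fset_uniq| |exact: sqr_ge0].
  by rewrite !inE js orbT.
rewrite -rinner_gram_sqr -[gram x F](subrK S) bopDE rinnerDl addrC.
have rle (T : bop H) : rinner (T v) v <= opnorm T.
  apply: le_trans (ler_norm _) _; apply: le_trans (rinner_le _ _) _.
  by rewrite -[leRHS]mulr1 ler_pM// rnorm_le1.
by rewrite lerD// (le_trans (rle _))// AP// fsubsetUl.
Qed.

Lemma l2_sum_opnorm x S (M : R) : l2_sum x S -> l2le x M -> opnorm S <= M ^+ 2.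
Proof.
move=> xS xM; apply/ler_addgt0Pr => eps e0.
have [A AP] := l2_sum_cvg xS e0.
rewrite -[S](subrK (gram x A)); apply: le_trans (opnormD _ _) _.
rewrite addrC lerD//; last by rewrite opnorm_distC AP.
by apply: opnorm_gram => [|v v1]; [exact: sqr_ge0|apply: xM; rewrite ?fset_uniq].
Qed.

Lemma l2_sum_tail x S : l2_sum x S -> l2tail x.
Proof.
move=> xS eps e0; have e2 : 0 < eps / 2 by lra.
have [A AP] := l2_sum_cvg xS e2; exists A => s us sA v v1.
pose F := (A `|` [fset j in s])%fset.
have AF : (A `<=` F)%fset by exact: fsubsetUl.
apply: (@le_trans _ _ (\sum_(j <- [seq j <- F | j \notin A]) rnorm (x j v) ^+ 2)).
  apply: sum_subset => // [|j js|j]; last exact: sqr_ge0.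
    by rewrite filter_uniq// fset_uniq.
  by rewrite mem_filter sA// !inE js orbT.
rewrite -rinner_gram_sqr -gram_sub//.
apply: le_trans (ler_norm _) _; apply: le_trans (rinner_le _ _) _.
apply: (@le_trans _ _ (opnorm (gram x F - gram x A))).
  by rewrite -[leRHS]mulr1 ler_pM// rnorm_le1.
apply: le_trans (opnorm_distD S _ _) _; rewrite [eps]splitr lerD// ?AP//.
by rewrite opnorm_distC AP.
Qed.

(** Small tails make the net of Gram sums Cauchy. Its limit is found along the increasing sets
    [G n], beyond which the sums vary by at most [n.+1%:R^-1]. *)
Lemma l2tail_sum x : (forall j, compact_op (x j)) -> l2tail x -> exists S, l2_sum x S.
Proof.
move=> cx tx; have /choice[F FP] := fun n => tx _ (@invSn_gt0 R n).
pose G := fix G n := if n is n'.+1 then (G n' `|` F n)%fset else F 0%N.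
have FG n : (F n `<=` G n)%fset by case: n => [|n]; [exact: fsubset_refl|exact: fsubsetUr].
have GG n k : (n <= k)%N -> (G n `<=` G k)%fset.
  elim: k => [|k IH]; first by rewrite leqn0 => /eqP->; exact: fsubset_refl.
  rewrite leq_eqVlt => /orP[/eqP->|]; first exact: fsubset_refl.
  by rewrite ltnS => /IH /fsubset_trans; apply; exact: fsubsetUl.
have close n A : (G n `<=` A)%fset -> opnorm (gram x A - gram x (G n)) <= n.+1%:R^-1.
  move=> GA; rewrite gram_sub//; apply: opnorm_gram => [|v v1]; first exact/ltW/invSn_gt0.
  apply: FP => // [|j]; first by rewrite filter_uniq// fset_uniq.
  by rewrite mem_filter => /andP[+ _]; apply: contra; exact/fsubsetP/FG.
have [|S SP] := @bop_complete _ _ (fun n => gram x (G n)).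
  move=> eps /exists_invSn_le[n nP]; exists n => k nk.
  by apply: le_trans nP; apply: close; exact: GG.
exists S; split.
  apply: compact_op_approx => eps /SP[n nP].
  exists (gram x (G n)); last by rewrite opnorm_distC nP.
  by apply: compact_op_sum => j _; exact: compact_opMl.
apply/cvgrPdist_le => eps e0; have e2 : 0 < eps / 2 by lra.
have [n nP] := SP _ e2; have [p pP] := exists_invSn_le e2.
pose k := maxn n p; exists (G k) => // A GA /=.
rewrite sub0r normrN partial_sumE ger0_norm//.
apply: le_trans (opnorm_distD (gram x (G k)) _ _) _.
rewrite [eps]splitr lerD ?nP ?leq_maxl//.
by apply: le_trans (close _ _ GA) _; apply: le_trans pP; rewrite ler_invSn// leq_maxr.
Qed.

Lemma l2AP x : l2A x <-> (forall j, compact_op (x j)) /\ l2tail x.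
Proof.
split=> [[cx [S xS]]|[cx tx]]; first by split=> //; exact: l2_sum_tail xS.
by split=> //; exact: l2tail_sum.
Qed.

Lemma l2A_norm_ge0 x : 0 <= l2A_norm x. Proof. exact: sqrtr_ge0. Qed.

Lemma l2A_norm_le x (M : R) : l2A x -> 0 <= M -> l2le x M -> l2A_norm x <= M.
Proof.
move=> [_ xS] M0 xM; rewrite -(ger0_norm M0) -sqrtr_sqr ler_wsqrtr//.
by apply: l2_sum_opnorm xM; exact: xgetPex.
Qed.

Lemma l2le_norm x : l2A x -> l2le x (l2A_norm x).
Proof.
move=> [_ xS] s us v v1; rewrite sqr_sqrtr//; apply: l2_sum_le => //.
exact: xgetPex.
Qed.

Lemma opnorm_l2A x j : l2A x -> opnorm (x j) <= l2A_norm x.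
Proof.
move=> /l2le_norm xl; apply: opnorm_le_ball => v v1.
rewrite -(@ler_pXn2r _ 2) ?nnegrE ?l2A_norm_ge0//.
by have := xl [:: j] isT v v1; rewrite big_seq1.
Qed.

Lemma sqr_rnormB_le (V : normedZmodType R[i]) (v w : V) :
  rnorm (v - w) ^+ 2 <= (rnorm v ^+ 2 + rnorm w ^+ 2) *+ 2.
Proof.
have := ler_rnormB v w; have := rnorm_ge0 (v - w); have := rnorm_ge0 v; have := rnorm_ge0 w.
move: (rnorm _) (rnorm v) (rnorm w) => a b c c0 b0 a0 abc.
have := sqr_ge0 (b - c); nra.
Qed.

Lemma l2A_sub x y : l2A x -> l2A y -> l2A (x - y).
Proof.
move=> /l2AP[cx tx] /l2AP[cy ty]; apply/l2AP; split=> [j|eps e0].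
  by apply: compact_opD => //; exact: compact_opN.
have e4 : 0 < eps / 4 by lra.
have [F FP] := tx _ e4; have [G GP] := ty _ e4.
exists (F `|` G)%fset => s us sFG v v1.
have sF j : j \in s -> j \notin F by move=> /sFG; rewrite inE; case/norP.
have sG j : j \in s -> j \notin G by move=> /sFG; rewrite inE; case/norP.
apply: (@le_trans _ _ (\sum_(j <- s) (rnorm (x j v) ^+ 2 + rnorm (y j v) ^+ 2) *+ 2)).
  by apply: ler_sum => j _; exact: sqr_rnormB_le.
rewrite sumrMnl big_split /=.
have := FP s us sF v v1; have := GP s us sG v v1; lra.
Qed.

(** A triangle inequality with a spare factor 2, which follows termwise from [sqr_rnormB_le] and
    suffices for density arguments. *)
Lemma l2le_sub x y (a b : R) : 0 <= a -> 0 <= b -> l2le x a -> l2le y b ->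
  l2le (x - y) ((a + b) *+ 2).
Proof.
move=> a0 b0 xa yb s us v v1.
apply: (@le_trans _ _ (\sum_(j <- s) (rnorm (x j v) ^+ 2 + rnorm (y j v) ^+ 2) *+ 2)).
  by apply: ler_sum => j _; exact: sqr_rnormB_le.
rewrite sumrMnl big_split /=.
have := xa s us v v1; have := yb s us v v1; nra.
Qed.

(** The l1 norm dominates the module norm by [l1le_l2le] and is estimated coordinate by coordinate;
    the constructions are carried out in it. *)
Definition l1le x (M : R) := forall s, uniq s -> \sum_(j <- s) opnorm (x j) <= M.

Lemma l1le_l2le x (M : R) : l1le x M -> l2le x M.
Proof.
move=> xM s us v v1.
have M0 : 0 <= M by have := xM [::] isT; rewrite big_nil.
apply: (@le_trans _ _ ((\sum_(j <- s) opnorm (x j)) ^+ 2)); last first.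
  by rewrite ler_pXn2r ?nnegrE// ?sumr_ge0// xM.
elim: s {us} => [|j s IH]; first by rewrite !big_nil expr0n.
rewrite !big_cons sqrrD; apply: lerD IH.
have h : rnorm (x j v) <= opnorm (x j) by exact: rnorm_le1.
have S0 : 0 <= \sum_(j <- s) opnorm (x j) by rewrite sumr_ge0.
have := opnorm_ge0 (x j); have := rnorm_ge0 (x j v); nra.
Qed.

Lemma l1le_add x y (a b : R) : l1le x a -> l1le y b -> l1le (x + y) (a + b).
Proof.
move=> xa yb s us; apply: (le_trans _ (lerD (xa s us) (yb s us))).
by rewrite -big_split /=; apply: ler_sum => j _; exact: opnormD.
Qed.

Definition supported x F := forall j, j \notin F -> x j = 0.

(** Outside the finite support of a nearby [c], the sequences [x] and [x - c] coincide, so the tails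
    of [x] are small. *)
Lemma l1_closure_l2A x : (forall j, compact_op (x j)) ->
  (forall r : R, 0 < r -> exists c F, supported c F /\ l1le (x - c) r) -> l2A x.
Proof.
move=> cx xc; apply/l2AP; split=> // eps e0.
have [r r0 re] : exists2 r : R, 0 < r & r ^+ 2 <= eps.
  by exists (Num.sqrt eps); rewrite ?sqrtr_gt0 ?sqr_sqrtr// ltW.
have [c [F [cF xcr]]] := xc _ r0; exists F => s us sF v v1.
apply: le_trans re; apply: le_trans (l1le_l2le xcr us v1); rewrite le_eqVlt; apply/orP; left; apply/eqP.
rewrite big_seq [RHS]big_seq; apply: eq_bigr => j /sF/cF cj.
by rewrite [(x - c) j](_ : _ = x j - c j)// cj subr0.
Qed.

Lemma supported_l2A x F : (forall j, compact_op (x j)) -> supported x F -> l2A x.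
Proof.
move=> cx xF; apply: l1_closure_l2A => // r r0; exists x, F; split=> // s us.
by rewrite big1 ?ltW// => j _; rewrite subrr opnorm0.
Qed.

Lemma l2A_truncate x (eps : R) : l2A x -> 0 < eps ->
  exists F, l2le (fun j => if j \in F then 0 else x j) eps.
Proof.
move=> /l2AP[_ tx] e0; have [F FP] := tx _ (exprn_gt0 2 e0); exists F => s us v v1.
rewrite (bigID (fun j => j \in F)) /= big1 ?add0r => [|j ->]; last by rewrite bop0E rnorm0 expr0n.
rewrite -big_filter (eq_big_seq (fun j => rnorm (x j v) ^+ 2)) => [|j]; last first.
  by rewrite mem_filter => /andP[/negPf->].
by apply: FP => // [|j]; [exact: filter_uniq|rewrite mem_filter => /andP[]].
Qed.

End StandardModule.

(** * Iterates of weighted shifts *)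

Section WeightedShift.
Context {R : realType} {H : hilbertType R}.
Implicit Types (W : int -> bop H) (U : bop H) (x y : int -> bop H) (j : int) (n p : nat).

Lemma inverseP (T : bop H) : invertible T -> is_inverse T (inverse T).
Proof. exact: xgetPex. Qed.

Lemma forward_prod_to0 W j : forward_prod_to W j 0 = 1.
Proof. exact: big_ord0. Qed.

Lemma forward_prod_toSl W j n :
  forward_prod_to W j n.+1 = W j * forward_prod_to W (j - 1) n.
Proof.
rewrite /forward_prod_to big_ord_recl /= subr0; congr (_ * _).
by apply: eq_bigr => i _; congr W; rewrite /bump; lia.
Qed.

Lemma forward_prod_toSr W j n :
  forward_prod_to W j n.+1 = forward_prod_to W j n * W (j - n%:Z).
Proof. exact: big_ord_recr. Qed.

Lemma forward_prod_toD W j p n :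
  forward_prod_to W j (p + n) = forward_prod_to W j p * forward_prod_to W (j - p%:Z) n.
Proof.
elim: p j => [|p IH] j; first by rewrite forward_prod_to0 mul1r subr0.
rewrite addSn !forward_prod_toSl IH mulrA; congr (_ * forward_prod_to W _ n).
by rewrite -(addn1 p) PoszD; ring.
Qed.

Lemma forward_prodE W j n : forward_prod W j n = forward_prod_to W (j + n%:Z) n.
Proof. by []. Qed.

Lemma backward_prodS W j n :
  backward_prod W j n.+1 = inverse (W (j - n%:Z)) * backward_prod W j n.
Proof.
rewrite /backward_prod big_ord_recl /=; congr (inverse (W _) * _).
  by rewrite -(addn1 n) PoszD; ring.
by apply: eq_bigr => i _; congr (inverse (W _)); rewrite /bump; lia.
Qed.

Lemma iter_weighted_shift U W n x j :
  iter n (weighted_shift U W) x j = forward_prod_to W j n * x (j - n%:Z) * U ^+ n.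
Proof.
elim: n j => [|n IH] j; first by rewrite forward_prod_to0 mul1r mulr1 subr0.
rewrite iterS /weighted_shift IH forward_prod_toSl exprSr !mulrA.
by congr (_ * x _ * _ * _); rewrite -(addn1 n) PoszD; ring.
Qed.

Lemma iter_weighted_shiftB U W n x y :
  iter n (weighted_shift U W) (x - y) =
  iter n (weighted_shift U W) x - iter n (weighted_shift U W) y.
Proof.
apply/funext => j; rewrite [RHS](_ : _ = iter n (weighted_shift U W) x j -
  iter n (weighted_shift U W) y j)// !iter_weighted_shift.
by rewrite -mulrBl -mulrBr.
Qed.

Lemma iter_compact U W n x :
  (forall j, compact_op (x j)) -> forall j, compact_op (iter n (weighted_shift U W) x j).
Proof. by move=> cx j; rewrite iter_weighted_shift; exact/compact_opMr/compact_opMl. Qed.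

Section Products.
Variable W : int -> bop H.
Hypothesis Winv : forall j, invertible (W j).

Lemma forward_backward j n : forward_prod_to W j n * backward_prod W j n = 1.
Proof.
elim: n => [|n IH]; first by rewrite forward_prod_to0 mul1r; exact: big_ord0.
rewrite forward_prod_toSr backward_prodS -mulrA (mulrA (W _)).
by have [_ ->] := inverseP (Winv (j - n%:Z)); rewrite mul1r.
Qed.

Lemma backward_forward j n : backward_prod W j n * forward_prod_to W j n = 1.
Proof.
elim: n => [|n IH]; first by rewrite forward_prod_to0 mulr1; exact: big_ord0.
rewrite forward_prod_toSr backward_prodS -mulrA (mulrA (backward_prod _ _ _)) IH mul1r.
by have [-> _] := inverseP (Winv (j - n%:Z)).
Qed.

End Products.

Section Unitary.
Variable U : bop H.
Hypothesis hU : unitary U.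

Lemma unitary_inner v w : inner (U v) (U w) = inner v w.
Proof. by case: hU => UU _; rewrite innerTl -bopME UU. Qed.

Lemma unitary_rnorm v : rnorm (U v) = rnorm v.
Proof. by apply/eqP; rewrite -(@eqrXn2 _ 2)// -!rinnerxx /rinner unitary_inner. Qed.

Lemma unitaryX_inner n v w : inner ((U ^+ n) v) ((U ^+ n) w) = inner v w.
Proof.
elim: n v w => [|n IH] v w; first by rewrite expr0.
by rewrite exprS !bopME unitary_inner IH.
Qed.

Lemma opnorm_unitaryX n : opnorm (U ^+ n) <= 1.
Proof.
by apply: opnormX_le1; apply: opnorm_le => // v; rewrite unitary_rnorm mul1r.
Qed.

Lemma opnorm_adjoint_unitaryX n : opnorm (adjoint U ^+ n) <= 1.
Proof.
apply: opnormX_le1; apply: le_trans (opnorm_adjoint_le U) _.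
exact: (opnorm_unitaryX 1).
Qed.

Lemma adjoint_unitaryXl n : adjoint U ^+ n * U ^+ n = 1.
Proof.
elim: n => [|n IH]; first by rewrite mul1r.
by rewrite exprSr exprS -mulrA (mulrA (adjoint U)) (proj1 hU) mul1r.
Qed.

Lemma adjoint_unitaryXr n : U ^+ n * adjoint U ^+ n = 1.
Proof.
elim: n => [|n IH]; first by rewrite mul1r.
by rewrite exprSr exprS -mulrA (mulrA U) (proj2 hU) mul1r.
Qed.

Lemma inner_adjointX n v w : inner ((adjoint U ^+ n) v) w = inner v ((U ^+ n) w).
Proof.
by rewrite -(unitaryX_inner n) -bopME adjoint_unitaryXr.
Qed.

End Unitary.

Section Bounds.
Variables (W : int -> bop H) (U : bop H) (M : R).
Hypothesis hU : unitary U.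
Hypothesis WM : forall j, opnorm (W j) <= M.
Hypothesis WM' : forall j, opnorm (inverse (W j)) <= M.

Lemma opnorm_forward_prod_to j n : opnorm (forward_prod_to W j n) <= M ^+ n.
Proof. exact: opnorm_prod_le. Qed.

Lemma opnorm_backward_prod j n : opnorm (backward_prod W j n) <= M ^+ n.
Proof. exact: opnorm_prod_le. Qed.

Lemma opnorm_iter n x j :
  opnorm (iter n (weighted_shift U W) x j) <= M ^+ n * opnorm (x (j - n%:Z)).
Proof.
rewrite iter_weighted_shift -[leRHS]mulr1; apply: opnormM_le; last exact: opnorm_unitaryX.
by apply: opnormM_le => //; exact: opnorm_forward_prod_to.
Qed.

(** Up to the factor [M ^+ n] the iterate only moves coordinates by [n], so the bound on [x] is
    applied to the translated indices. *)
Lemma l1le_iter n x (a : R) :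
  l1le x a -> l1le (iter n (weighted_shift U W) x) (M ^+ n * a).
Proof.
have M0 : 0 <= M by apply: le_trans (WM 0).
move=> xa s us; have := xa (map (fun j => j - n%:Z) s).
rewrite map_inj_uniq; last exact: addIr.
move=> /(_ us); rewrite big_map => h.
apply: (@le_trans _ _ (M ^+ n * \sum_(j <- s) opnorm (x (j - n%:Z)))).
  by rewrite mulr_sumr; apply: ler_sum => j _; exact: opnorm_iter.
by rewrite ler_wpM2l// exprn_ge0.
Qed.

End Bounds.
End WeightedShift.

Lemma common_bound (R : realType) (I : finType) (f : I -> int -> R) :
  (forall l, exists M, forall j, f l j <= M) -> exists M, forall l j, f l j <= M.
Proof.
move=> /choice[M MP]; exists (\big[Num.max/0]_l M l) => l j.
by apply: le_trans (MP l j) _; exact: le_bigmax.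
Qed.

(** * Absolutely summable sequences of operators *)

Section SummableSequences.
Context {R : realType} {H : hilbertType R}.
Implicit Types (x y : int -> bop H).

Lemma l1le_supported x (F : seq int) (d : R) : 0 <= d -> (forall j, j \notin F -> x j = 0) ->
  (forall j, opnorm (x j) <= d) -> l1le x (d *+ size F).
Proof.
move=> d0 xF xd s us; rewrite (bigID (fun j => j \in F)) /= [X in _ + X]big1 ?addr0; last first.
  by move=> j /xF->; exact: opnorm0.
rewrite -big_filter; apply: (@le_trans _ _ (\sum_(j <- [seq j <- s | j \in F]) d)).
  by apply: ler_sum.
rewrite big_const_seq count_predT iter_addr addr0 -!(mulr_natr d) ler_wpM2l// ler_nat.
by apply: uniq_leq_size => [|j]; [exact: filter_uniq|rewrite mem_filter => /andP[]].
Qed.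

Lemma l1le_interval x (a : int) (J : nat) (d : R) : 0 <= d ->
  (forall j : int, (J < `|(j - a)%R|)%N -> x j = 0) ->
  (forall j, opnorm (x j) <= d) -> l1le x (d *+ J.*2.+1).
Proof.
move=> d0 xJ xd; pose F := [seq a + ((i : nat)%:Z - J%:Z) | i <- iota 0 J.*2.+1].
have -> : J.*2.+1 = size F by rewrite size_map size_iota.
apply: l1le_supported => // j jF; apply: xJ; rewrite ltnNge; apply: contra jF => jJ.
apply/mapP; exists `|(j - a + J%:Z)%R|%N; last by lia.
by rewrite mem_iota; lia.
Qed.

(** The shape of both estimates for the vector built from the criterion: one piece near the origin
    or its image, and one piece for each of the [N] shifts. *)
Lemma l1le_split N x (A : int -> bop H) (B : 'I_N -> int -> bop H) (a d : R) :
  (forall j, x j = A j + \sum_(l < N) B l j) -> l1le A a -> (forall l, l1le (B l) d) ->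
  l1le x (a + d *+ N).
Proof.
move=> xE Aa Bd s us.
apply: (@le_trans _ _ (\sum_(j <- s) (opnorm (A j) + \sum_(l < N) opnorm (B l j)))).
  apply: ler_sum => j _; rewrite xE; apply: le_trans (opnormD _ _) _.
  by rewrite lerD2l; exact: ler_opnorm_sum.
rewrite big_split lerD ?Aa//= exchange_big /=.
apply: (@le_trans _ _ (\sum_(l < N) d)); first by apply: ler_sum => l _; exact: Bd.
by rewrite sumr_const card_ord.
Qed.

Lemma l1le_opnorm x (a : R) j : l1le x a -> opnorm (x j) <= a.
Proof. by move=> /(_ [:: j] isT); rewrite big_seq1. Qed.

(** Each coordinate converges in operator norm, and the l1 bound passes to the limit because it is
    tested on finitely many coordinates at a time. *)
Lemma l1_complete (u : nat -> int -> bop H) (r : nat -> R) :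
  (forall k p, (k <= p)%N -> l1le (u p - u k) (r k)) ->
  (forall eps, 0 < eps -> exists k, r k <= eps) ->
  exists x, forall k, l1le (x - u k) (r k).
Proof.
move=> uC r0.
have /choice[x xP] : forall j, exists S, forall eps : R, 0 < eps ->
    exists n, forall k, (n <= k)%N -> opnorm (u k j - S) <= eps.
  move=> j; apply: bop_complete => eps /r0[n rn]; exists n => k nk.
  by apply: le_trans rn; exact: (@l1le_opnorm (u k - u n) _ j (uC _ _ nk)).
exists x => k s us; apply/ler_addgt0Pr => eps e0.
have [p kp sp] : exists2 p, (k <= p)%N & \sum_(j <- s) opnorm (x j - u p j) <= eps.
  suff [n nP] : exists n, forall p, (n <= p)%N -> \sum_(j <- s) opnorm (x j - u p j) <= eps.
    by exists (maxn k n); [exact: leq_maxl|rewrite nP ?leq_maxr].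
  elim: s {us} eps e0 => [|j s IH] eps e0; first by exists 0%N => p _; rewrite big_nil ltW.
  have e2 : 0 < eps / 2 by lra.
  have [n nP] := IH _ e2; have [q qP] := xP j _ e2; exists (maxn n q) => p.
  rewrite geq_max => /andP[np qp]; rewrite big_cons [eps]splitr lerD ?nP//.
  by rewrite opnorm_distC qP.
apply: (@le_trans _ _ (\sum_(j <- s) (opnorm ((u p - u k) j) + opnorm (x j - u p j)))).
  by apply: ler_sum => j _; rewrite [leRHS]addrC; exact: (opnorm_distD (u p j) (x j) (u k j)).
by rewrite big_split /=; apply: lerD => //; exact: uC.
Qed.

End SummableSequences.

(** * Finitely supported sequences with rational entries *)

Section Codes.
Context {R : realType} {H : hilbertType R} (e : int -> H).
Hypothesis he : orthonormal_basis e.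

(* The pair [(j, s)] puts [ratop s] at coordinate [j]; unlike finitely supported
   sequences of operators, codes form a countable type. *)
Definition code := seq (int * seq (int * int * (rat * rat))).

Definition code_seq (c : code) (j : int) : bop H := \sum_(a <- c | a.1 == j) ratop e a.2.

Lemma compact_code c j : compact_op (code_seq c j).
Proof. by apply: compact_op_sum => a _; exact: compact_ratop. Qed.

Lemma code_supported c : supported (code_seq c) [fset a.1 | a in c]%fset.
Proof.
move=> j jc; rewrite /code_seq big_seq_cond big1// => a /andP[ac /eqP aj].
by move: jc; rewrite -aj in_imfset.
Qed.

Lemma code_l1_dense (x : int -> bop H) F (eps : R) : (forall j, compact_op (x j)) ->
  supported x F -> 0 < eps -> exists c, l1le (x - code_seq c) eps.
Proof.
(* The error is shared among the coordinates of [F]; the successor covers an empty [F]. *)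
move=> cx xF e0; have d0 : 0 < eps / (size F).+1%:R by rewrite divr_gt0.
have /choice[s sP] := fun j => ratop_dense he (cx j) d0.
pose c : code := [seq (j, s j) | j <- F].
have cE j : code_seq c j = if j \in F then ratop e (s j) else 0.
  rewrite /code_seq big_map /=; case: ifPn => jF.
    by rewrite -big_filter (filter_pred1_uniq (fset_uniq F) jF) big_seq1.
  by rewrite big_seq_cond big1// => i /andP[iF /eqP ij]; rewrite -ij iF in jF.
exists c => t ut.
apply: (@le_trans _ _ (eps / (size F).+1%:R *+ size F)).
  apply: l1le_supported ut; first exact: ltW.
    by move=> j jF; rewrite [LHS](_ : _ = x j - code_seq c j)// cE (negPf jF) xF// subrr.
  move=> j; rewrite [X in opnorm X](_ : _ = x j - code_seq c j)// cE.
  by case: ifPn => jF; [exact: sP|rewrite xF// subrr opnorm0 ltW].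
rewrite -mulr_natr -mulrA ler_piMr//; first exact: ltW.
by rewrite ler_pdivrMl ?ltr0n// mulr1 ler_nat.
Qed.

Lemma code_l2_dense (x : int -> bop H) (eps : R) : l2A x -> 0 < eps ->
  exists c, l2le (x - code_seq c) eps.
Proof.
move=> xA e0; have e4 : 0 < eps / 4 by lra.
have [F FP] := l2A_truncate xA e4; have [cx _] := (l2AP x).1 xA.
pose y j := if j \in F then x j else 0.
have cy j : compact_op (y j) by rewrite /y; case: ifP => // _; exact: compact_op0.
have [|c cP] := @code_l1_dense y F _ cy _ e4; first by move=> j jF; rewrite /y (negPf jF).
exists c; rewrite (_ : eps = (eps / 4 + eps / 4) *+ 2); last by lra.
(* With [y] the truncation of [x] to [F], the difference splits into the tail of [x] and the error
   of the code on [y]. *)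
rewrite (_ : x - _ = (fun j => if j \in F then 0 else x j) - (code_seq c - y)).
  apply: l2le_sub; rewrite ?ltW//; apply: l1le_l2le => s us.
  rewrite (eq_bigr (fun j => opnorm ((y - code_seq c) j))) ?cP// => j _.
  exact: opnorm_distC.
apply/funext => j; rewrite [LHS](_ : _ = x j - code_seq c j)//.
rewrite [RHS](_ : _ = (if j \in F then 0 else x j) - (code_seq c j - y j))// /y.
by case: ifP => _; [rewrite sub0r opprB|rewrite subr0].
Qed.

Lemma lproj_mulS m p (T : bop H) : (m <= p)%N -> lproj e m * T = T -> lproj e p * T = T.
Proof.
move=> mp mT; rewrite -{1 2}mT; apply: bop_eq => v; rewrite !bopME.
by apply: lproj_id => //; apply: (Lspan_mono he mp); exact: Lspan_lproj.
Qed.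

Lemma lproj_ratop s : exists m, lproj e m * ratop e s = ratop e s.
Proof.
elim: s => [|c s [m mP]]; first by exists 0%N; rewrite /ratop big_nil mulr0.
exists (maxn `|c.1.1| m); rewrite /ratop big_cons mulrDr; congr (_ + _).
  apply: bop_eq => v; rewrite bopME bopZE rkE !bopZ lproj_onb//; exact: leq_maxl.
by apply: lproj_mulS mP; exact: leq_maxr.
Qed.

(** The second condition says that $P_m$ fixes the entries, so multiplying them on the left by an
    operator close to $P_m$ changes them little. *)
Definition boxed (J m : nat) (x : int -> bop H) :=
  (forall j : int, (J < `|j|)%N -> x j = 0) /\ forall j, lproj e m * x j = x j.

Lemma boxed_le J m J' m' x : (J <= J')%N -> (m <= m')%N -> boxed J m x -> boxed J' m' x.
Proof.
move=> JJ mm [xJ xm]; split=> j; first by move=> /(leq_ltn_trans JJ); exact: xJ.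
exact: lproj_mulS (xm j).
Qed.

Lemma boxed_code c : exists J m, boxed J m (code_seq c).
Proof.
elim: c => [|a c [J [m [cJ cm]]]].
  by exists 0%N, 0%N; split=> j; rewrite /code_seq big_nil// mulr0.
have [p pP] := lproj_ratop a.2.
exists (maxn `|a.1| J), (maxn p m); split=> j.
  rewrite gtn_max => /andP[aj Jj]; rewrite /code_seq big_cons.
  by case: eqP aj => [->|_ _]; [rewrite ltnn|exact: cJ].
rewrite /code_seq big_cons; case: eqP => _; last by apply: lproj_mulS (cm j); exact: leq_maxr.
rewrite mulrDr (lproj_mulS _ pP) ?leq_maxl//; congr (_ + _).
by apply: lproj_mulS (cm j); exact: leq_maxr.
Qed.

Lemma boxed_codes (I : finType) (Y : I -> code) :
  exists J m, forall l, boxed J m (code_seq (Y l)).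
Proof.
have /choice[J /choice[m JmP]] := fun l => boxed_code (Y l).
exists (\max_l J l)%N, (\max_l m l)%N => l.
by apply: boxed_le (JmP l); exact: leq_bigmax.
Qed.

Lemma code_bound c : exists C : R, forall j, opnorm (code_seq c j) <= C.
Proof.
exists (\sum_(a <- c) opnorm (ratop e a.2)) => j.
apply: le_trans (ler_opnorm_sum _ _ _) _; rewrite big_mkcond /=.
by apply: ler_sum => a _; case: ifP.
Qed.

Lemma codes_bound (I : finType) (Y : I -> code) :
  exists C : R, forall l j, opnorm (code_seq (Y l) j) <= C.
Proof. by apply: common_bound => l; exact: code_bound. Qed.

End Codes.

(** * From the finitary criterion to simultaneous approximation *)

Lemma opnormMr_le (R : realType) (H : hilbertType R) (S T : bop H) (a : R) :
  opnorm S <= a -> opnorm T <= 1 -> opnorm (S * T) <= a.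
Proof. by move=> Sa T1; rewrite -[leRHS]mulr1; exact: opnormM_le. Qed.

Section Criterion.
Context {R : realType} {H : hilbertType R} (e : int -> H).
Context {N : nat} (W : 'I_N -> int -> bop H).

Definition shift_criterion (J m : nat) (eps : R) (n : nat) :=
  exists (D : int -> bop H) (G : 'I_N -> int -> bop H), forall j : int, (`|j| <= J)%N ->
  [/\ compact_op (D j) /\ (forall l, compact_op (G l j)),
      opnorm (D j - lproj e m) <= eps,
      forall l, [/\ opnorm (G l j - lproj e m) <= eps,
        opnorm (forward_prod (W l) j n * D j) <= eps &
        opnorm (backward_prod (W l) j n * G l j) <= eps] &
      forall s l, s != l ->
        opnorm (forward_prod_to (W s) j n * backward_prod (W l) j n * G l j) <= eps].

End Criterion.

Section Sufficiency.
Context {R : realType} {H : hilbertType R} (e : int -> H).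
Hypothesis he : orthonormal_basis e.
Context {N : nat} (W : 'I_N -> int -> bop H) (U : 'I_N -> bop H).
Hypothesis Winv : forall l j, invertible (W l j).
Hypothesis hU : forall l, unitary (U l).
Hypothesis crit : forall J m, (0 < J)%N -> (0 < m)%N -> forall eps : R, 0 < eps ->
  exists n, shift_criterion e W J m eps n.

Let T l := weighted_shift (U l) (W l).

Lemma shift_transitive_compact (u : int -> bop H) (Y : 'I_N -> int -> bop H) (J m : nat) (C : R) :
  (0 < J)%N -> (0 < m)%N -> boxed e J m u -> (forall l, boxed e J m (Y l)) ->
  (forall j, compact_op (u j)) -> (forall l j, compact_op (Y l j)) ->
  (forall j, opnorm (u j) <= C) -> (forall l j, opnorm (Y l j) <= C) ->
  forall delta : R, 0 < delta -> exists n (x : int -> bop H) (F : {fset int}),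
  [/\ forall j, compact_op (x j), supported x F, l1le (x - u) delta &
      forall l, l1le (iter n (T l) x - Y l) delta].
Proof.
move=> J0 m0 [uJ um] Ybox cu cY uC YC delta d0.
have C0 : 0 <= C by apply: le_trans (uC 0).
(* There are [N.+1] pieces, each with at most [J.*2.+1] coordinates of norm at most [eps * C];
   [C + 1] keeps the denominator positive. *)
pose eps := delta / ((C + 1) * J.*2.+1%:R * N.+1%:R).
have C1 : 0 < C + 1 by lra.
have e0 : 0 < eps by rewrite divr_gt0// !mulr_gt0.
have epsE : eps * C *+ J.*2.+1 + eps * C *+ J.*2.+1 *+ N <= delta.
  have <- : eps * ((C + 1) * J.*2.+1%:R * N.+1%:R) = delta.
    by rewrite divfK// gt_eqF// !mulr_gt0.
  rewrite -mulrS -(mulr_natr (_ *+ _)) -(mulr_natr (_ * C)) !mulrA ler_pM2r ?ltr0n// ler_pM2r ?ltr0n//.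
  by rewrite ler_pM2l// lerDl.
clearbody eps; have [n [D [G DG]]] := crit J0 m0 e0.
pose Du j := if (`|j| <= J)%N then D j * u j else 0.
(* The factor [adjoint (U l) ^+ n] will cancel the power of [U l] produced by the iterate. *)
pose V l (j : int) := if (`|(j + n%:Z)%R| <= J)%N then
  backward_prod (W l) (j + n%:Z) n * G l (j + n%:Z) * Y l (j + n%:Z) * adjoint (U l) ^+ n else 0.
pose x j := Du j + \sum_(l < N) V l j.
have eC : 0 <= eps * C by rewrite mulr_ge0// ltW.
have adjU l : opnorm (adjoint (U l) ^+ n) <= 1 by exact: opnorm_adjoint_unitaryX.
have Un l : opnorm (U l ^+ n) <= 1 by exact: opnorm_unitaryX.
(* The support is covered by the interval $[J]$ and its translate by $-n$, which may overlap. *)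
exists n, x, [fset j in ([seq (i : nat)%:Z - J%:Z | i <- iota 0 J.*2.+1] ++
  [seq (i : nat)%:Z - J%:Z - n%:Z | i <- iota 0 J.*2.+1])]%fset; split.
- move=> j; apply: compact_opD.
    by rewrite /Du; case: ifP => _; [exact: compact_opMl|exact: compact_op0].
  apply: compact_op_sum => l _; rewrite /V; case: ifP => _; last exact: compact_op0.
  by apply: compact_opMr; exact: compact_opMl.
- move=> j jF.
  have {jF} : j \notin [seq (i : nat)%:Z - J%:Z | i <- iota 0 J.*2.+1] ++
      [seq (i : nat)%:Z - J%:Z - n%:Z | i <- iota 0 J.*2.+1].
    by apply: contra jF => jF; apply/imfsetP; exists j.
  rewrite mem_cat => /norP[/mapP h1 /mapP h2].
  rewrite /x /Du /V; case: ifP => jJ.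
    by exfalso; apply: h1; exists `|(j + J%:Z)%R|%N; [rewrite mem_iota; lia|lia].
  rewrite big1 ?addr0// => l _; case: ifP => // jnJ.
  by exfalso; apply: h2; exists `|(j + J%:Z + n%:Z)%R|%N; [rewrite mem_iota; lia|lia].
- move=> s us; apply: le_trans epsE; move: s us.
  apply: (@l1le_split _ _ N _ (Du - u) V) => [j||l].
  + by rewrite [LHS](_ : _ = x j - u j)// /x addrAC.
  + apply: (@l1le_interval _ _ _ 0) => // [j jJ|j].
      rewrite subr0 in jJ; rewrite [LHS](_ : _ = Du j - u j)// /Du leqNgt jJ /=.
      by rewrite uJ// subrr.
    rewrite [X in opnorm X](_ : _ = Du j - u j)// /Du; case: ifPn => jJ.
      have [_ DP _ _] := DG j jJ.
      by rewrite -[X in _ - X]um -mulrBl opnormM_le.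
    by rewrite -ltnNge in jJ; rewrite uJ// subrr opnorm0.
  + apply: (@l1le_interval _ _ _ (- n%:Z)) => // [j jJ|j].
      by rewrite opprK in jJ; rewrite /V leqNgt jJ.
    rewrite /V; case: ifPn => jJ; last by rewrite opnorm0.
    have [_ _ /(_ l)[_ _ BG] _] := DG _ jJ.
    by apply: opnormMr_le => //; exact: opnormM_le.
- move=> s t ut; apply: le_trans epsE; move: t ut.
  (* The images of the pieces under the iterate of the [s]-th shift; the target is subtracted from
     the piece with [l == s]. *)
  pose A j := forward_prod_to (W s) j n * Du (j - n%:Z) * U s ^+ n.
  pose B l j := forward_prod_to (W s) j n * V l (j - n%:Z) * U s ^+ n -
    (if l == s then Y s j else 0).
  apply: (@l1le_split _ _ N _ A B) => [j||l].
  + rewrite [LHS](_ : _ = iter n (T s) x j - Y s j)// iter_weighted_shift /x.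
    rewrite mulrDr mulrDl -addrA; congr (_ + _).
    rewrite mulr_sumr mulr_suml /B sumrB; congr (_ - _).
    by rewrite -big_mkcond big_pred1_eq.
  + apply: (@l1le_interval _ _ _ n%:Z) => // [j jJ|j].
      by rewrite /A /Du leqNgt jJ mulr0 mul0r.
    rewrite /A /Du; case: ifPn => jJ; last by rewrite mulr0 mul0r opnorm0.
    have [_ _ /(_ s)[_ FD _] _] := DG _ jJ.
    rewrite forward_prodE subrK in FD.
    by rewrite mulrA; apply: opnormMr_le => //; exact: opnormM_le.
  + apply: (@l1le_interval _ _ _ 0) => // [j jJ|j].
      rewrite subr0 in jJ; rewrite /B /V subrK leqNgt jJ /= mulr0 mul0r sub0r.
      by have [YJ _] := Ybox s; rewrite YJ// if_same oppr0.
    rewrite /B /V subrK; case: ifPn => jJ; last first.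
      rewrite -ltnNge in jJ; rewrite mulr0 mul0r sub0r.
      by have [YJ _] := Ybox s; rewrite YJ// if_same oppr0 opnorm0.
    have [_ _ /(_ l)[GP _ _] cross] := DG _ jJ.
    (* For [l = s] the weights and the unitary powers cancel, leaving $G_{s,j}y_j-y_j$ with $y$ the
       target [Y s]; otherwise the cross condition makes the piece small. *)
    case: eqVneq => [->|ls].
      rewrite !mulrA forward_backward// mul1r -mulrA adjoint_unitaryXl// mulr1.
      have [_ Ym] := Ybox s.
      by rewrite -[X in _ - X]Ym -mulrBl opnormM_le//; case: (DG _ jJ) => _ _ /(_ s)[].
    rewrite subr0 [X in opnorm X](_ : _ = (forward_prod_to (W s) j n * backward_prod (W l) j n * G l j) * Y l j *
      (adjoint (U l) ^+ n * U s ^+ n)); last by rewrite !mulrA.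
    apply: opnormMr_le; last exact: opnormMr_le.
    by apply: opnormM_le => //; apply: cross; rewrite eq_sym.
Qed.

End Sufficiency.

(** * Construction of disjoint hypercyclic vectors by nested l1 balls *)

Section L1Distance.
Context {R : realType} {H : hilbertType R}.
Implicit Types (x y z : int -> bop H).

Lemma l1le_distC x y (a : R) : l1le (x - y) a -> l1le (y - x) a.
Proof.
move=> xy s us; rewrite (eq_bigr (fun j => opnorm ((x - y) j))) ?xy// => j _.
exact: opnorm_distC.
Qed.

Lemma l1le_distD z x y (a b : R) : l1le (x - z) a -> l1le (z - y) b -> l1le (x - y) (a + b).
Proof. by move=> xz zy; have := l1le_add xz zy; rewrite subrKA. Qed.

Lemma l1le_le x (a b : R) : a <= b -> l1le x a -> l1le x b.
Proof. by move=> ab xa s us; apply: le_trans ab; exact: xa. Qed.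

End L1Distance.

Lemma mulr_eighth_lt (R : realType) (d : R) : 0 < d -> d / 8 *+ 4 < d.
Proof. lra. Qed.

Section DenseOrbits.
Context {R : realType} {H : hilbertType R} (e : int -> H).
Hypothesis he : orthonormal_basis e.
Context {N : nat} (W : 'I_N -> int -> bop H) (U : 'I_N -> bop H) (M : R).
Hypothesis M1 : 1 <= M.
Hypothesis Winv : forall l j, invertible (W l j).
Hypothesis WM : forall l j, opnorm (W l j) <= M.
Hypothesis hU : forall l, unitary (U l).
Hypothesis crit : forall J m, (0 < J)%N -> (0 < m)%N -> forall eps : R, 0 < eps ->
  exists n, shift_criterion e W J m eps n.

Let T l := weighted_shift (U l) (W l).
Let cseq := code_seq e.

(** The vector obtained for compact entries is replaced by a code within [delta / 2 / M ^+ n], since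
    [n] iterations multiply errors by at most [M ^+ n]. *)
Lemma shift_transitive (u : code) (Y : 'I_N -> code) (delta : R) : 0 < delta ->
  exists n c, l1le (cseq c - cseq u) delta /\
    forall l, l1le (iter n (T l) (cseq c) - cseq (Y l)) delta.
Proof.
move=> d0.
have [J1 [m1 uB]] := boxed_code he u; have [J2 [m2 YB]] := boxed_codes he Y.
have [C1 uC] := code_bound e u; have [C2 YC] := codes_bound e Y.
(* The successors provide the positivity that [crit] asks for. *)
pose J := (maxn J1 J2).+1; pose m := (maxn m1 m2).+1; pose C := Num.max C1 C2.
have d2 : 0 < delta / 2 by lra.
have [||||||||n [x [F [cx xF xu xY]]]] :=
    @shift_transitive_compact _ _ _ _ W U Winv hU crit (cseq u)
      (fun l => cseq (Y l)) J m C _ _ _ _ _ _ _ _ _ d2 => //.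
- by apply: boxed_le uB => //; rewrite leqW// leq_maxl.
- by move=> l; apply: boxed_le (YB l) => //; rewrite leqW// leq_maxr.
- by move=> j; exact: compact_code.
- by move=> l j; exact: compact_code.
- by move=> j; rewrite le_max uC.
- by move=> l j; rewrite le_max YC orbT.
have Mn1 : 1 <= M ^+ n by exact: exprn_ege1.
have Mn0 : 0 < M ^+ n by apply: lt_le_trans Mn1.
have d2M : 0 < delta / 2 / M ^+ n by rewrite divr_gt0.
have [c cP] := code_l1_dense he cx xF d2M.
exists n, c; split=> [|l]; rewrite [delta]splitr.
  apply: l1le_distD xu; apply: l1le_le (l1le_distC cP).
  by rewrite ler_pdivrMr// ler_peMr// ltW.
apply: l1le_distD (xY l); rewrite -iter_weighted_shiftB.
rewrite [delta / 2](_ : _ = M ^+ n * (delta / 2 / M ^+ n)); last by rewrite [RHS]mulrC divfK ?gt_eqF.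
by apply: l1le_iter => //; exact: l1le_distC.
Qed.

Lemma iter_direct_sum n (y : 'I_N -> int -> bop H) l :
  iter n (direct_sum T) y l = iter n (T l) (y l).
Proof. by elim: n => [|n IH] //; rewrite !iterS /direct_sum IH. Qed.

Lemma iter_l2A l n x : (forall j, compact_op (x j)) ->
  (forall r : R, 0 < r -> exists c, l1le (x - cseq c) r) -> l2A (iter n (T l) x).
Proof.
move=> cx xc; apply: l1_closure_l2A => [|r r0]; first exact: iter_compact.
have Mn0 : 0 < M ^+ n by rewrite exprn_gt0// (lt_le_trans ltr01).
have [c cP] := xc _ (divr_gt0 r0 Mn0).
pose A := [fset a.1 | a in c]%fset.
exists (iter n (T l) (cseq c)), [fset (j + n%:Z)%R | j in A]%fset; split.
  move=> j jA; rewrite iter_weighted_shift (_ : cseq c _ = 0) ?mulr0 ?mul0r//.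
  apply: code_supported; apply: contra jA => jA; apply/imfsetP.
  by exists (j - n%:Z); rewrite ?subrK.
rewrite -iter_weighted_shiftB [r](_ : _ = M ^+ n * (r / M ^+ n)); last first.
  by rewrite mulrC divfK ?gt_eqF.
exact: l1le_iter.
Qed.

(* Step [k] of the construction moves the current code by at most half of the
   current radius so that its orbit meets the [k]-th target (a family of codes
   and a tolerance, listed by [unpickle]); the new radius is so small that all
   sequences in the new ball still do. *)
Let target_type : countType := ({ffun 'I_N -> code} * nat)%type.
Let target (k : nat) : option target_type := choice.unpickle k.

Let hits (k : nat) (c : code) (r : R) :=
  if target k is Some (Y, q) then exists n : nat,
    M ^+ n * r <= q.+1%:R^-1 /\ forall l, l1le (iter n (T l) (cseq c) - cseq (Y l)) q.+1%:R^-1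
  else True.

(** The pair [p] exists for every [r], so that choice yields a total step function; for [r <= 0] any
    value serves. *)
Lemma code_step k (c : code) (r : R) : exists p : code * R, 0 < r ->
  [/\ 0 < p.2, p.2 <= r / 2, l1le (cseq p.1 - cseq c) (r / 2) & hits k p.1 p.2].
Proof.
case: (ltP 0 r) => [r0|_]; last by exists (c, r).
have r2 : 0 < r / 2 by lra.
rewrite /hits; case: (target k) => [[Y q]|]; last first.
  exists (c, r / 2) => _; split=> //= s us.
  by rewrite big1 ?ltW// => j _; rewrite subrr opnorm0.
pose t := Num.min (r / 2) q.+1%:R^-1.
have t0 : 0 < t by rewrite lt_min r2 invSn_gt0.
have [n [c' [cc' cY]]] := @shift_transitive c Y t t0.
have Mn0 : 0 < M ^+ n by rewrite exprn_gt0// (lt_le_trans ltr01).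
exists (c', Num.min (r / 2) (q.+1%:R^-1 / M ^+ n)) => _ /=; split.
- by rewrite lt_min r2 divr_gt0// invSn_gt0.
- by rewrite ge_min lexx.
- by apply: l1le_le cc'; rewrite ge_min lexx.
- exists n; split=> [|l]; first by rewrite mulrC -ler_pdivlMr// ge_min lexx orbT.
  by apply: l1le_le (cY l); rewrite ge_min lexx orbT.
Qed.

Lemma dense_orbits_near (c0 : code) (r0 : R) : 0 < r0 -> exists x : int -> bop H,
  [/\ l1le (x - cseq c0) r0, forall j, compact_op (x j),
      forall r : R, 0 < r -> exists c, l1le (x - cseq c) r &
      forall (Y : 'I_N -> code) (eps : R), 0 < eps ->
        exists n, forall l, l1le (iter n (T l) x - cseq (Y l)) eps].
Proof.
move=> r00.
have /choice[f fP] : forall q : nat * (code * R), exists p : code * R, 0 < q.2.2 ->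
    [/\ 0 < p.2, p.2 <= q.2.2 / 2, l1le (cseq p.1 - cseq q.2.1) (q.2.2 / 2) & hits q.1 p.1 p.2].
  by move=> [k [c r]]; exact: code_step.
pose st := fix st k := if k is k'.+1 then f (k', st k') else (c0, r0).
pose u k := cseq (st k).1; pose r k := (st k).2.
have r_gt0 k : 0 < r k by elim: k => // k IH; have [] := fP (k, st k) IH.
have stP k : [/\ r k.+1 <= r k / 2, l1le (u k.+1 - u k) (r k / 2) & hits k (st k.+1).1 (r k.+1)].
  by have [] := fP (k, st k) (r_gt0 k).
(* Subtracting [r p] makes the induction telescope: a step moves by [r p / 2], and the next radius
   is at most [r p / 2]. *)
have ucauchy k p : (k <= p)%N -> l1le (u p - u k) (r k - r p).
  move=> /subnKC <-; elim: (p - k)%N => [|d IH].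
    by rewrite addn0 !subrr => s us; rewrite big1// => j _; exact: opnorm0.
  rewrite addnS; have [h1 h2 _] := stP (k + d)%N.
  by apply: l1le_le (l1le_distD h2 IH); lra.
have r_small eps : 0 < eps -> exists k, r k <= eps.
  (* Halving gives geometric decay, but the weaker harmonic bound is enough. *)
  move=> e0; have rk k : r k <= r0 * k.+1%:R^-1.
    elim: k => [|k IH]; first by rewrite invr1 mulr1.
    have [h _ _] := stP k; apply: le_trans h _; apply: le_trans (ler_wpM2r _ IH) _; first by rewrite invr_ge0 ler0n.
    rewrite -mulrA ler_pM2l// -invfM lef_pV2 ?posrE ?mulr_gt0 ?ltr0n//.
    by rewrite -natrM ler_nat; lia.
  have [k kP] := exists_invSn_le (divr_gt0 e0 r00); exists k.
  by apply: le_trans (rk k) _; rewrite mulrC -ler_pdivlMr.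
have [|x xP] := @l1_complete _ _ u r _ r_small.
  by move=> k p kp; apply: l1le_le (ucauchy k p kp); rewrite gerBl ltW.
exists x; split; first exact: (xP 0%N).
- move=> j; apply: compact_op_approx => eps /r_small[k rk].
  exists (u k j); first exact: compact_code.
  by apply: le_trans rk; exact: (l1le_opnorm j (xP k)).
- by move=> eps /r_small[k rk]; exists (st k).1; exact: l1le_le (xP k).
- move=> Y eps e0; have e2 : 0 < eps / 2 by lra.
  have [q qP] := exists_invSn_le e2.
  (* Step [k] treats exactly this target. One tolerance covers the iterate of the code, the other
     the distance from the limit to the code, multiplied by [M ^+ n]. *)
  pose k := choice.pickle (([ffun l => Y l], q) : target_type).
  have [_ _] := stP k; rewrite /hits /target choice.pickleK => -[n [rn uY]].
  exists n => l; rewrite [eps]splitr; apply: l1le_le (lerD qP qP) _.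
  have := uY l; rewrite ffunE => uYl; apply: l1le_distD uYl.
  rewrite -iter_weighted_shiftB; apply: l1le_le rn _; apply: l1le_iter => //.
  exact: (xP k.+1).
Qed.

(** The factor 4 comes from the spare factor in [l2le_sub] and explains the radii [eps / 8] and
    [d / 8] below. *)
Lemma l2A_norm_near (x y : int -> bop H) (c : code) (a : R) : 0 <= a -> l2A x -> l2A y ->
  l1le (x - cseq c) a -> l2le (y - cseq c) a -> l2A_norm (x - y) <= a *+ 4.
Proof.
move=> a0 xA yA xc yc; apply: l2A_norm_le; [exact: l2A_sub|by rewrite mulrn_wge0|].
rewrite (_ : x - y = (x - cseq c) - (y - cseq c)); last by rewrite opprB addrA subrK.
rewrite (_ : a *+ 4 = (a + a) *+ 2); last by rewrite -mulr2n -mulrnA.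
by apply: l2le_sub => //; exact: l1le_l2le.
Qed.

Lemma criterion_densely_disjoint_hypercyclic :
  densely_disjoint_hypercyclic (@l2A R H) (@l2A_norm R H) T.
Proof.
split=> [x [] //|z zA eps e0].
have e8 : 0 < eps / 8 by lra.
have [c0 c0P] := code_l2_dense he zA e8.
have [x [xc0 cx xapp xorb]] := dense_orbits_near c0 e8.
have xA : l2A x.
  apply: l1_closure_l2A => // r /xapp[c cP].
  by exists (cseq c), [fset a.1 | a in c]%fset; split=> //; exact: code_supported.
exists x; last first.
  apply: le_lt_trans (l2A_norm_near (ltW e8) xA zA xc0 c0P) _.
  exact: mulr_eighth_lt.
split=> //; split=> [_ [n _ <-] l|y yA d d0].
  by rewrite iter_direct_sum; exact: iter_l2A.
have d8 : 0 < d / 8 by lra.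
have /choice[Y YP] := fun l => code_l2_dense he (yA l) d8.
have [n nP] := xorb Y _ d8.
exists (iter n (direct_sum T) (fun=> x)); first by exists n.
apply: bigmax_lt => // l _; rewrite [X in l2A_norm X](_ : _ = iter n (T l) x - y l); last first.
  by rewrite -(iter_direct_sum n (fun=> x)).
apply: le_lt_trans (l2A_norm_near (ltW d8) _ (yA l) (nP l) (YP l)) _; first exact: iter_l2A.
exact: mulr_eighth_lt.
Qed.

End DenseOrbits.

(** * Bessel's inequality and almost orthogonal blocks *)

Section Bessel.
Context {R : realType} {H : hilbertType R}.

(** Both [rinner x y] and the square norm of [y] equal the sum [A], so the square norm of [x - y] is
    that of [x] minus [A]. *)
Lemma bessel (f : int -> H) (x : H) (s : seq int) :
  (forall i j, inner (f i) (f j) = (i == j)%:R) -> uniq s ->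
  \sum_(i <- s) rnorm (inner x (f i)) ^+ 2 <= rnorm x ^+ 2.
Proof.
move=> ff us; pose y := \sum_(i <- s) inner x (f i) *: f i.
pose A := \sum_(i <- s) rnorm (inner x (f i)) ^+ 2.
have sqE (a : R[i]) : complex.Re (a * a^*%C) = rnorm a ^+ 2.
  by rewrite -sqr_normc rnormE -rmorphXn.
have yf i : i \in s -> inner y (f i) = inner x (f i).
  move=> si; rewrite inner_suml (bigD1_seq i)//= innerZl ff eqxx mulr1.
  by rewrite big1 ?addr0// => j /negPf ji; rewrite innerZl ff ji mulr0.
have xy : rinner x y = A.
  rewrite /rinner inner_sumr raddf_sum; apply: eq_bigr => i _ /=.
  by rewrite innerZr mulrC sqE.
have yy : rnorm y ^+ 2 = A.
  rewrite -rinnerxx {2}/y /rinner inner_sumr raddf_sum big_seq [RHS]big_seq.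
  by apply: eq_bigr => i si /=; rewrite innerZr yf// mulrC sqE.
have := sqr_ge0 (rnorm (x - y)); rewrite rnormB_sqr xy yy -/A; lra.
Qed.

End Bessel.

Section AlmostOrthogonalBlocks.
Context {R : realType} {H : hilbertType R} (e : int -> H).
Hypothesis he : orthonormal_basis e.
Variable m : nat.
Local Notation d := (m.*2.+1).

(* Block [0] is the basis of [L_m] and block [v] its translate by [d * v];
   [blockin v] is the partial isometry of [L_m] onto the span of block [v], and
   [blockout v] its adjoint. *)
Definition block (v i : nat) : H := e (i%:Z - m%:Z + (d * v)%:Z).

Definition blockin (v : nat) : bop H := \sum_(i < d) rk (block v i) (e (i%:Z - m%:Z)).
Definition blockout (v : nat) : bop H := \sum_(i < d) rk (e (i%:Z - m%:Z)) (block v i).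

Lemma inner_block v i j : inner (block v i) (block v j) = (i == j)%:R.
Proof. by rewrite inner_onb// !(inj_eq (addIr _)). Qed.

Lemma opnorm_blockin v : opnorm (blockin v) <= d%:R.
Proof.
apply: le_trans (ler_opnorm_sum _ _ _) _.
apply: (@le_trans _ _ (\sum_(i < d) 1)); last by rewrite sumr_const card_ord.
apply: ler_sum => i _; apply: le_trans (opnorm_rk _ _) _.
by rewrite !rnorm_onb// mul1r.
Qed.

Lemma compact_blockin v : compact_op (blockin v).
Proof. by apply: compact_op_sum => i _; exact: compact_rk. Qed.

Lemma compact_blockout v : compact_op (blockout v).
Proof. by apply: compact_op_sum => i _; exact: compact_rk. Qed.

Lemma blockout_blockin v : blockout v * blockin v = lproj e m.
Proof.
apply: bop_eq => x; rewrite bopME lprojE [LHS]bop_sumE; apply: eq_bigr => i _.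
rewrite rkE bop_sumE inner_suml.
under eq_bigr do rewrite rkE innerZl inner_block.
rewrite (bigD1 i)//= eqxx mulr1 big1 ?addr0// => j /negPf ji.
by rewrite val_eqE ji mulr0.
Qed.

(** The product is a sum of [d * d] rank-one operators between basis vectors whose coefficients are
    these inner products. *)
Lemma opnorm_block_sandwich a b (V : bop H) (eta : R) :
  (forall i k : 'I_d, rnorm (inner (V (block b k)) (block a i)) <= eta) ->
  opnorm (blockout a * V * blockin b) <= eta *+ d *+ d.
Proof.
move=> Veta; have eta0 : 0 <= eta by apply: le_trans (Veta ord0 ord0).
rewrite /blockout /blockin mulr_suml mulr_suml.
apply: le_trans (ler_opnorm_sum _ _ _) _.
rewrite -[X in _ <= _ *+ X]card_ord -sumr_const; apply: ler_sum => i _.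
rewrite mulr_sumr; apply: le_trans (ler_opnorm_sum _ _ _) _.
rewrite -[X in _ <= _ *+ X]card_ord -sumr_const; apply: ler_sum => k _.
apply: opnorm_le => // x; rewrite !bopME !rkE bopZ innerZl rnormZ rnormM rnorm_onb// mulr1.
rewrite mulrC ler_pM//; apply: le_trans (inner_le _ _) _.
by rewrite rnorm_onb// mulr1.
Qed.

Context {N : nat} (U : 'I_N -> bop H).
Hypothesis hU : forall l, unitary (U l).

Let g n (s l : 'I_N) (i k : 'I_d) (t u : nat) : R :=
  rnorm (inner ((U l ^+ n) (block (t + u * l) k)) ((U s ^+ n) (block (t + u * s) i))) ^+ 2.

(* The blocks of index [t + u * l] and [t + u * s] determine [u] and [t] when
   [s != l], so that Bessel's inequality bounds the sum over all pairs by a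
   quantity linear in [Q]. *)
Lemma sum_block_overlap n s l i k Q : s != l ->
  \sum_(t < Q) \sum_(u < Q) g n s l i k t u <= (Q * N.+1)%:R.
Proof.
move=> sl; rewrite exchange_big /=.
(* Substitute [c = t + u * l]; the other block then has index $c+u(s-l)$. *)
pose h (c u : nat) : R := rnorm (inner ((U l ^+ n) (block c k))
  ((U s ^+ n) (e (i%:Z - m%:Z + d%:Z * (c%:Z + u%:Z * (s%:Z - l%:Z)))))) ^+ 2.
have h0 c u : 0 <= h c u by exact: sqr_ge0.
(* The range of [c], which depends on [u], is enlarged to a common interval so that the sums can be
   exchanged. *)
apply: (@le_trans _ _ (\sum_(u < Q) \sum_(0 <= c < Q * N.+1) h c u)).
  apply: ler_sum => u _; have uQ := ltn_ord u; have lN := ltn_ord l.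
  have ul : (u * l + Q <= Q * N.+1)%N by nia.
  rewrite (@big_cat_nat _ _ _ (u * l)%N)//=; last by lia.
  rewrite (@big_cat_nat _ _ _ (u * l + Q)%N (u * l)%N)//=; last by lia.
  rewrite addrCA [leLHS](_ : _ = \sum_(u * l <= c < u * l + Q) h c u).
    by rewrite lerDl addr_ge0// sumr_ge0.
  rewrite -[X in \sum_(X <= _ < _) _]add0n big_addn addKn big_mkord; apply: eq_bigr => t _.
  have E : block (t + u * s) i =
      e (i%:Z - m%:Z + d%:Z * ((t + u * l)%N%:Z + u%:Z * (s%:Z - l%:Z))).
    by congr e; rewrite PoszM !PoszD !PoszM; ring.
  by rewrite /g E.
rewrite exchange_big /=.
apply: (@le_trans _ _ (\sum_(0 <= c < Q * N.+1) 1)); last first.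
  by rewrite big_const_nat iter_addr addr0 subn0.
apply: ler_sum => c _.
pose ix (u : nat) := i%:Z - m%:Z + d%:Z * (c%:Z + u%:Z * (s%:Z - l%:Z)).
(* For fixed [c], distinct [u] give distinct basis vectors because [s != l]; Bessel then bounds the
   sum over [u] by 1. *)
have inj_ix : injective ix.
  move=> u u' /addrI /mulfI -/(_ isT) /addrI /mulIf; rewrite subr_eq0 eqz_nat val_eqE.
  by move=> /(_ sl) [].
have ff j j' : inner ((U s ^+ n) (e j)) ((U s ^+ n) (e j')) = (j == j')%:R.
  by rewrite unitaryX_inner// inner_onb.
have <- : \sum_(u <- iota 0 Q) h c u = \sum_(u < Q) h c u.
  by rewrite -(big_mkord xpredT) /index_iota subn0.
have us : uniq (map ix (iota 0 Q)) by rewrite map_inj_uniq ?iota_uniq.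
have := bessel ((U l ^+ n) (block c k)) ff us.
have -> : rnorm ((U l ^+ n) (block c k)) = 1.
  apply/eqP; rewrite -(@eqrXn2 _ 2)// -rinnerxx /rinner unitaryX_inner//.
  by rewrite inner_block eqxx expr1n.
by rewrite big_map expr1n.
Qed.

(* Averaging over the [Q ^ 2] pairs [(t, u)]. *)
Lemma almost_orthogonal_blocks (eta : R) : 0 < eta -> exists Q, forall n,
  exists t u, [/\ (t < Q)%N, (u < Q)%N & forall s l, s != l -> forall i k : 'I_d,
    rnorm (inner ((U l ^+ n) (block (t + u * l) k)) ((U s ^+ n) (block (t + u * s) i))) <= eta].
Proof.
move=> eta0; pose I : finType := ('I_N * 'I_N * ('I_d * 'I_d))%type.
pose B : R := (N.+1 * #|I|)%:R.
(* If every pair failed, the total overlap would be at least [Q ^ 2 * eta ^ 2], whereas it is at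
   most [Q * B]. *)
have [Q Q0 BQ] : exists2 Q : nat, (0 < Q)%N & B < Q%:R * eta ^+ 2.
  exists (truncn (B / eta ^+ 2)).+1 => //; rewrite -ltr_pdivrMr ?exprn_gt0//.
  by rewrite real_truncnS_gt ?num_real.
exists Q => n; apply: contrapT => /forallNP nt.
pose S (t u : nat) := \sum_(p : I | p.1.1 != p.1.2) g n p.1.1 p.1.2 p.2.1 p.2.2 t u.
(* A total below [eta ^+ 2] bounds every single overlap, so the pair would be good. *)
have S_ge (t u : 'I_Q) : eta ^+ 2 <= S t u.
  rewrite leNgt; apply/negP => Slt; apply: (nt t); exists u; split=> // s l sl i k.
  rewrite -(@ler_pXn2r _ 2) ?nnegrE//; last exact: ltW.
  apply: le_trans (ltW Slt).
  rewrite /S (bigD1 (s, l, (i, k)))//= lerDl sumr_ge0// => p _; exact: sqr_ge0.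
have : \sum_(t < Q) \sum_(u < Q) eta ^+ 2 <= \sum_(p : I | p.1.1 != p.1.2) (Q * N.+1)%:R.
  apply: (@le_trans _ _ (\sum_(t < Q) \sum_(u < Q) S t u)).
    by do 2!apply: ler_sum => ? _; exact: S_ge.
  rewrite /S; under eq_bigr do rewrite exchange_big.
  rewrite exchange_big /=; apply: ler_sum => p sl.
  exact: sum_block_overlap.
have : \sum_(p : I | p.1.1 != p.1.2) (Q * N.+1)%:R <= Q%:R * B.
  rewrite big_const iter_addr addr0 -(mulr_natr (Q * N.+1)%:R) /B -!natrM ler_nat mulnA.
  by rewrite leq_mul2l max_card orbT.
move=> h1 h2; have := le_trans h2 h1.
rewrite !big_const !card_ord !iter_addr !addr0 -(mulr_natl (_ *+ Q)) ler_pM2l ?ltr0n//.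
by rewrite -(mulr_natl (eta ^+ 2)) leNgt BQ.
Qed.

End AlmostOrthogonalBlocks.

Lemma ltn_square_pair Q t u : (t < Q)%N -> (u < Q)%N -> (t * Q + u < Q * Q)%N.
Proof.
move=> tQ uQ; apply: (@leq_trans (t * Q + Q)%N); first by rewrite ltn_add2l.
by rewrite -mulSnr leq_mul2r tQ orbT.
Qed.

(** * From disjoint hypercyclicity to the finitary criterion *)

Section Necessity.
Context {R : realType} {H : hilbertType R} (e : int -> H).
Hypothesis he : orthonormal_basis e.
Context {N : nat} (W : 'I_N -> int -> bop H) (U : 'I_N -> bop H) (M : R).
Hypothesis N0 : (0 < N)%N.
Hypothesis M1 : 1 <= M.
Hypothesis Winv : forall l j, invertible (W l j).
Hypothesis WM : forall l j, opnorm (W l j) <= M.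
Hypothesis WM' : forall l j, opnorm (inverse (W l j)) <= M.
Hypothesis hU : forall l, unitary (U l).
Let T l := weighted_shift (U l) (W l).
Hypothesis ddh : densely_disjoint_hypercyclic (@l2A R H) (@l2A_norm R H) T.

Lemma interval_l2A (x : int -> bop H) (K : nat) :
  (forall j, compact_op (x j)) -> (forall j : int, (K < `|j|)%N -> x j = 0) -> l2A x.
Proof.
move=> cx xK; apply: (@supported_l2A _ _ x [fset j in [seq (i : nat)%:Z - K%:Z | i <- iota 0 K.*2.+1]]%fset) => //.
move=> j jF; apply: xK; rewrite ltnNge; apply: contra jF => jK.
have jm : j \in [seq (i : nat)%:Z - K%:Z | i <- iota 0 K.*2.+1].
  by apply/mapP; exists `|(j + K%:Z)%R|%N; [rewrite mem_iota; lia|lia].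
by apply/imfsetP; exists j.
Qed.

(* A marker of norm [C] at one coordinate, where the first [n1] iterates are
   smaller than [C], forces the iterate approximating [y] to be later. *)
Lemma late_approximation (x : int -> bop H) (y : 'I_N -> int -> bop H) (n1 : nat) (j0 : int)
    (C delta : R) :
  disjoint_hypercyclic_vector (@l2A R H) (@l2A_norm R H) T x -> 0 < delta ->
  (forall l, l2A (y l)) -> (forall l, C <= opnorm (y l j0)) ->
  M ^+ n1 * l2A_norm x + delta < C ->
  exists2 n, (n1 < n)%N & forall l j, opnorm (iter n (T l) x j - y l j) <= delta.
Proof.
move=> [xA [orb dens]] d0 yA yC Cx.
have [_ [n _ <-] ny] := dens y yA _ d0.
have near l j : opnorm (iter n (T l) x j - y l j) <= delta.
  have TA : l2A (iter n (T l) x).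
    by rewrite -(iter_direct_sum W U n (fun=> x)); apply: orb; exists n.
  apply: le_trans (ltW ny); apply: le_trans (opnorm_l2A j (l2A_sub TA (yA l))) _.
  rewrite /power_norm; apply: le_trans (le_bigmax _ _ l).
  by rewrite [X in _ <= l2A_norm X](_ : _ = iter n (T l) x - y l)// -(iter_direct_sum W U n (fun=> x)).
exists n => //; rewrite ltnNge; apply/negP => nn1.
pose l := Ordinal N0; have := yC l.
suff : opnorm (y l j0) < C by move=> /lt_le_trans h /h; rewrite ltxx.
apply: le_lt_trans Cx; rewrite -[y l j0](subrK (iter n (T l) x j0)).
apply: le_trans (opnormD _ _) _; rewrite addrC lerD//; last by rewrite opnorm_distC.
apply: le_trans (opnorm_iter (hU l) (WM l) n x j0) _.
by apply: ler_pM => //; [rewrite exprn_ge0// (le_trans ler01)|exact: ler_weXn2l|exact: opnorm_l2A].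
Qed.

Variables (J m : nat).
Local Notation d := (m.*2.+1).
Local Notation L := (J.*2.+1).

(* The window number [q = t * Q + u], at distance [L * q], is the one whose
   block indices are [t + u * l]. *)
Let window_target (Q : nat) (C : R) (l : 'I_N) (i : int) : bop H :=
  if (0 <= i + J%:Z) && (`|(i + J%:Z)%R| < L * (Q * Q))%N then
    let q := (`|(i + J%:Z)%R| %/ L)%N in
    forward_prod (W l) (i - (L * q)%N%:Z) (L * q) * blockout e m (q %/ Q + q %% Q * l)
  else if i == - J%:Z - 1 then C%:C *: lproj e m else 0.

Lemma window_target_l2A Q C l : l2A (window_target Q C l).
Proof.
apply: (@interval_l2A _ (L * (Q * Q) + J.+1)) => j; rewrite /window_target.
  case: ifP => _; first exact/compact_opMl/compact_blockout.
  case: ifP => _; last exact: compact_op0.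
  have -> : C%:C *: lproj e m = (C%:C *: (1 : bop H)) * lproj e m by exact: bop_eq.
  exact/compact_opMl/compact_lproj.
move=> jK; case: ifP => [/andP[h1 h2]|_]; first by exfalso; clear -jK h1 h2; lia.
by case: eqP => // jE; exfalso; clear -jK jE; lia.
Qed.

(** Division of [j + p + J] by the window length recovers the window number, and division of that by
    [Q] recovers [t] and [u]. *)
Lemma window_targetE Q C l (j : int) t u : (`|j| <= J)%N -> (t < Q)%N -> (u < Q)%N ->
  let p := (L * (t * Q + u))%N in
  window_target Q C l (j + p%:Z) = forward_prod (W l) j p * blockout e m (t + u * l).
Proof.
move=> jJ tQ uQ p; set q := (t * Q + u)%N in p *.
have qQ : (q < Q * Q)%N by exact: ltn_square_pair.
have E : `|(j + p%:Z + J%:Z)%R|%N = (q * L + `|(j + J%:Z)%R|)%N.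
  by rewrite /p mulnC; clear -jJ; move: (q * L)%N => z; lia.
have r0 : (`|(j + J%:Z)%R| < L)%N by clear -jJ; lia.
have qE : ((q * L + `|(j + J%:Z)%R|) %/ L = q)%N.
  by rewrite divnMDl// divn_small// addn0.
rewrite /window_target E qE ifT; last first.
  apply/andP; split; first by rewrite /p; clear -jJ; lia.
  apply: (@leq_trans (q * L + L)%N); first by rewrite ltn_add2l.
  by rewrite -mulSnr mulnC leq_mul2l qQ orbT.
rewrite -/p addrK /q divnMDl; last by lia.
by rewrite divn_small// addn0 modnMDl modn_small.
Qed.

Lemma window_target_far Q C l (i : int) : (L * (Q * Q) + J < `|i|)%N -> 0 <= i ->
  window_target Q C l i = 0.
Proof.
move=> iL i0; rewrite /window_target ifF; last first.
  by apply/negP => /andP[_ h]; clear -iL i0 h; lia.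
by rewrite ifF//; apply/eqP => iE; clear -i0 iE; lia.
Qed.

(** The coordinate just to the left of all windows is free to carry the marker needed by
    [late_approximation]. *)
Lemma window_target_marker Q C l : window_target Q C l (- J%:Z - 1) = C%:C *: lproj e m.
Proof. by rewrite /window_target ifF ?eqxx//; apply/negP => /andP[h _]; clear -h; lia. Qed.

Lemma opnorm_marker (C : R) : 0 <= C -> C <= opnorm (C%:C *: lproj e m).
Proof.
move=> C0; have := @rnorm_le1 _ _ (C%:C *: lproj e m) (e 0).
rewrite rnorm_onb// bopZE lproj_onb// rnormZ rnorm_onb// rnorm_real ger0_norm// mulr1.
exact.
Qed.

(** The lower bound [n0] is arbitrary so that a strictly increasing sequence can be built
    afterwards. *)
Lemma densely_disjoint_hypercyclic_criterion (eps : R) (n0 : nat) : 0 < eps ->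
  exists2 n, (n0 < n)%N & shift_criterion e W J m eps n.
Proof.
move=> e0; have eps2 : eps / 2 <= eps by lra.
(* The [d * d] overlaps of two blocks together contribute [eps / 2] to the cross condition. *)
pose eta := eps / 2 / (d%:R * d%:R).
have dR0 : 0 < d%:R :> R by rewrite ltr0n.
have eta0 : 0 < eta by rewrite !divr_gt0// mulr_gt0.
have etaE : eta *+ d *+ d = eps / 2.
  rewrite -(mulr_natr (_ *+ _)) -(mulr_natr eta) -mulrA /eta divfK//.
  by rewrite gt_eqF// mulr_gt0.
have [Q QP] := almost_orthogonal_blocks he m hU eta0.
(* [K] bounds the weights across any window distance, and the factor [d] in [delta] pays for the
   norm of [blockin]. *)
pose K := M ^+ (L * (Q * Q)).
have K1 : 1 <= K by exact: exprn_ege1.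
have K0 : 0 < K by exact: lt_le_trans K1.
have M0 : 0 <= M by exact: le_trans M1.
pose delta := eps / 2 / (K * d%:R).
have delta0 : 0 < delta by rewrite !divr_gt0// mulr_gt0.
have deltaE : K * delta * d%:R = eps / 2.
  by rewrite (mulrC K) -mulrA /delta divfK// gt_eqF// mulr_gt0.
have d1 : 1 <= d%:R :> R by rewrite ler1n.
have deltaK : K * delta <= eps.
  apply: (@le_trans _ _ (eps / 2)); last exact: eps2.
  by rewrite -deltaE ler_peMr// mulr_ge0// ltW.
have delta_le : delta <= eps by apply: le_trans deltaK; rewrite ler_peMl// ltW.
have delta_d : delta * d%:R <= eps.
  apply: (@le_trans _ _ (eps / 2)); last exact: eps2.
  by rewrite -deltaE -mulrA ler_peMl// mulr_ge0// ltW.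
pose pseq (j : int) := if (`|j| <= J)%N then lproj e m else 0.
have pA : l2A pseq.
  apply: (@interval_l2A _ J) => j; rewrite /pseq.
    by case: ifP => _; [exact: compact_lproj|exact: compact_op0].
  by rewrite ltnNge => /negPf->.
have [x dhx xp] := proj2 ddh pseq pA _ delta0.
have xA : l2A x by case: dhx.
have [cx _] := proj1 (l2AP x) xA.
have xpj j : opnorm (x j - pseq j) <= delta.
  by apply: le_trans (ltW xp); exact: (opnorm_l2A j (l2A_sub xA pA)).
(* Even after the correction by the window distance, the exponent exceeds [n0 + J.*2]; the term
   [J.*2] makes $[J]-n'$ disjoint from $[J]$. *)
pose n1 := (n0 + L * (Q * Q) + J.*2)%N.
pose C := M ^+ n1 * l2A_norm x + delta + 1.
have C0 : 0 <= C.
  by rewrite /C addr_ge0// addr_ge0 ?(ltW delta0)// mulr_ge0 ?l2A_norm_ge0 ?exprn_ge0.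
have [|||n n1n Tn] := @late_approximation x (window_target Q C) n1 (- J%:Z - 1) C delta dhx delta0.
- by move=> l; exact: window_target_l2A.
- by move=> l; rewrite window_target_marker opnorm_marker.
- by rewrite /C ltrDl.
(* The blocks depend on [n], so the window is selected only now, and [n] is corrected by its
   distance [p]. *)
have [t [u [tQ uQ tuP]]] := QP n.
pose p := (L * (t * Q + u))%N.
have pQ : (p <= L * (Q * Q))%N by rewrite leq_mul2l orbC ltnW// ltn_square_pair.
have pn : (p <= n)%N by clear -pQ n1n; rewrite /n1 in n1n; lia.
pose n' := (n - p)%N.
have nE : n = (p + n')%N by rewrite /n' subnKC.
have n0n' : (n0 + J.*2 < n')%N by clear -pQ n1n nE; rewrite /n1 in n1n; lia.
have MpK : M ^+ p <= K by rewrite ler_weXn2l.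
(* This is the [n]-th iterate at [j + p] with its first [p] weights removed. The unitary power
   remains [n], the exponent for which the blocks were chosen. *)
pose E l j := forward_prod_to (W l) j n' * x (j - n'%:Z) * U l ^+ n.
have ES l (j : int) : (`|j| <= J)%N -> opnorm (E l j - blockout e m (t + u * l)) <= K * delta.
  move=> jJ; have := Tn l (j + p%:Z).
  rewrite window_targetE// -/p iter_weighted_shift nE forward_prod_toD addrK forward_prodE => h.
  apply: (@le_trans _ _ (M ^+ p * delta)); last by rewrite ler_wpM2r// ltW.
  rewrite -[_ - _]mul1r -(backward_forward (Winv l) (j + p%:Z) p) -mulrA.
  apply: opnormM_le; first exact: opnorm_backward_prod.
  apply: le_trans h; rewrite le_eqVlt; apply/orP; left; apply/eqP; congr opnorm.
  rewrite mulrBr /E !mulrA; congr (_ * _ * x _ * _ - _); last by rewrite nE.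
  by rewrite PoszD; ring.
(* As [E l j] is close to [blockout], multiplication by [blockin] brings it close to $P_m$. *)
pose G l j := E l j * blockin e m (t + u * l).
have bpG l j : backward_prod (W l) j n' * G l j =
    x (j - n'%:Z) * U l ^+ n * blockin e m (t + u * l).
  by rewrite /G /E !mulrA backward_forward// mul1r.
exists n'; first by clear -n0n'; lia.
exists x, G => j jJ; split.
- split=> // l; apply: compact_opMl; exact: compact_blockin.
- by apply: le_trans delta_le; have := xpj j; rewrite /pseq jJ.
- move=> l; split.
  + rewrite -(blockout_blockin he m (t + u * l)) -mulrBl.
    apply: (@le_trans _ _ (K * delta * d%:R)).
      by apply: opnormM_le; [exact: ES|exact: opnorm_blockin].
    by rewrite deltaE.
  + apply: le_trans deltaK.
    (* The coordinate [j + n] lies beyond every window, where the target vanishes. *)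
    have far : (L * (Q * Q) + J < `|(j + n%:Z)%R|)%N /\ 0 <= j + n%:Z.
      by clear -jJ n1n; rewrite /n1 in n1n; split; lia.
    have := Tn l (j + n%:Z); rewrite (window_target_far _ _ far.1 far.2) subr0.
    rewrite iter_weighted_shift addrK nE forward_prod_toD => h.
    apply: (@le_trans _ _ (M ^+ p * delta)); last by rewrite ler_wpM2r// ltW.
    rewrite -[forward_prod _ _ _ * _]mul1r -(backward_forward (Winv l) (j + (p + n')%N%:Z) p) -mulrA.
    apply: opnormM_le; first exact: opnorm_backward_prod.
    apply: le_trans (opnormMr_le h (opnorm_adjoint_unitaryX (hU l) (p + n'))).
    rewrite -mulrA adjoint_unitaryXr// mulr1 forward_prodE mulrA.
    rewrite (_ : j + (p + n')%N%:Z - p%:Z = j + n'%:Z)//.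
    by rewrite PoszD; ring.
  + rewrite bpG; apply: le_trans delta_d; apply: opnormM_le; last exact: opnorm_blockin.
    apply: opnormMr_le; last exact: opnorm_unitaryX.
    (* The index [j - n'] lies outside $[J]$, where [x] is close to zero. *)
    have := xpj (j - n'%:Z); rewrite /pseq ifF ?subr0//.
    by apply/negP => h; clear -h jJ n0n'; lia.
- move=> s l sl; rewrite -mulrA bpG.
  pose V := adjoint (U s) ^+ n * U l ^+ n.
  have V1 : opnorm V <= 1.
    by apply: opnormMr_le; [exact: opnorm_adjoint_unitaryX|exact: opnorm_unitaryX].
  rewrite (_ : _ * _ = E s j * V * blockin e m (t + u * l)); last first.
    rewrite /E /V !mulrA -(mulrA _ (U s ^+ n)) adjoint_unitaryXr// mulr1.
    by [].
  (* Replace [E s j] by [blockout]: the error is controlled by [ES], and what remains is a block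
     sandwich of [V]. *)
  rewrite -[E s j](subrK (blockout e m (t + u * s))) (mulrDl _ (blockout _ _ _) V) mulrDl.
  apply: le_trans (opnormD _ _) _; rewrite [eps]splitr; apply: lerD.
    rewrite -deltaE; apply: opnormM_le; last exact: opnorm_blockin.
    by apply: opnormMr_le => //; exact: ES.
  rewrite -etaE; apply: opnorm_block_sandwich => // i k.
  by rewrite bopME inner_adjointX//; exact: tuP.
Qed.

End Necessity.

(** * Condition (2) and its finitary form *)

Lemma cvg0_le (R : realType) (a : nat -> R) (eps : R) :
  a k @[k --> \oo] --> (0 : R) -> 0 < eps -> exists n, forall k, (n <= k)%N -> a k <= eps.
Proof.
move=> /cvgrPdist_le a0 /a0[n _ nP]; exists n => k /nP /=.
by rewrite sub0r normrN; apply: le_trans; exact: ler_norm.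
Qed.

Lemma cvg0_invS (R : realType) (a : nat -> R) :
  (forall k, 0 <= a k) -> (forall k, a k <= k.+1%:R^-1) -> a k @[k --> \oo] --> (0 : R).
Proof.
move=> a0 ak; apply/cvgrPdist_le => eps /exists_invSn_le[n nP]; exists n => // k nk /=.
by rewrite sub0r normrN ger0_norm// (le_trans (ak k))// (le_trans _ nP)// ler_invSn.
Qed.

Lemma eventually_forall (I : finType) (P : I -> nat -> Prop) :
  (forall i, exists n, forall k, (n <= k)%N -> P i k) ->
  exists n, forall k, (n <= k)%N -> forall i, P i k.
Proof.
move=> /choice[n nP]; exists (\max_i n i)%N => k nk i; apply: nP.
by apply: leq_trans nk; exact: leq_bigmax.
Qed.

Theorem theorem3p4 (R : realType) (H : hilbertType R) (e : int -> H)
  (N : nat) (W : 'I_N -> int -> bop H) (U : 'I_N -> bop H)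
  (he : orthonormal_basis e)
  (hN : (2 <= N)%N)
  (hWinv : forall l j, invertible (W l j))
  (hW : forall l, uniformly_bounded (W l))
  (hW' : forall l, uniformly_bounded (fun j => inverse (W l j)))
  (hU : forall l, unitary (U l))
  (hperp : forall m : nat, (0 < m)%N ->
    exists Nm : nat, forall n : nat, (Nm <= n)%N ->
    forall s l : 'I_N, s != l ->
      orthogonal_sets
        ((U s ^+ n * inverse (U l) ^+ n : bop H) @` Lspan e m) (Lspan e m)) :
  densely_disjoint_hypercyclic (@l2A R H) (@l2A_norm R H)
    (fun l => weighted_shift (U l) (W l))
  <->
  (forall J m : nat, (0 < J)%N -> (0 < m)%N ->
    exists (n : nat -> nat) (D : int -> nat -> bop H)
           (G : 'I_N -> int -> nat -> bop H),
      [/\ (forall k, (0 < n k)%N) /\ (forall k, (n k < n k.+1)%N),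
          forall j : int, (`|j| <= J)%N ->
            (forall k, compact_op (D j k)) /\
            (forall l k, compact_op (G l j k)),
          forall j : int, (`|j| <= J)%N -> forall l : 'I_N,
            [/\ opnorm (D j k - orthoproj (Lspan e m)) @[k --> \oo] --> (0 : R),
                opnorm (G l j k - orthoproj (Lspan e m)) @[k --> \oo] --> (0 : R),
                opnorm (forward_prod (W l) j (n k) * D j k)
                  @[k --> \oo] --> (0 : R) &
                opnorm (backward_prod (W l) j (n k) * G l j k)
                  @[k --> \oo] --> (0 : R)] &
          forall j : int, (`|j| <= J)%N -> forall s l : 'I_N, s != l ->
            opnorm (forward_prod_to (W s) j (n k) *
                    backward_prod (W l) j (n k) * G l j k)
              @[k --> \oo] --> (0 : R)]).
Proof.
have [M [M1 [WM WM']]] : exists M : R, 1 <= M /\ (forall l j, opnorm (W l j) <= M) /\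
    (forall l j, opnorm (inverse (W l j)) <= M).
  have [M1 M1P] := common_bound hW; have [M2 M2P] := common_bound hW'.
  (* Including 1 makes the powers of [M] nondecreasing. *)
  exists (Num.max 1 (Num.max M1 M2)); split; first by rewrite le_max lexx.
  by split=> l j; rewrite !le_max ?M1P ?M2P ?orbT.
have N0 : (0 < N)%N by exact: ltn_trans hN.
split=> [ddh J m J0 m0|crit].
- have /choice[f fP] : forall q : nat * nat, exists n, (q.2 < n)%N /\
      shift_criterion e W J m q.1.+1%:R^-1 n.
    move=> [k p]; have [n pn nP] := densely_disjoint_hypercyclic_criterion he N0 M1 hWinv WM WM' hU ddh J m p (@invSn_gt0 R k).
    by exists n.
  (* The second argument of [f] is the previous exponent, so each exceeds the one before; the
     initial 0 gives positivity. *)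
  pose n := fix n k := if k is k'.+1 then f (k'.+1, n k') else f (0%N, 0%N).
  have nP k : shift_criterion e W J m k.+1%:R^-1 (n k).
    by case: k => [|k]; [have [] := fP (0%N, 0%N)|have [] := fP (k.+1, n k)].
  have /choice[D /choice[G DG]] := nP.
  exists n, (fun j k => D k j), (fun l j k => G k l j); rewrite orthoproj_Lspan//; split.
  + split=> k; last by have [] := fP (k.+1, n k).
    case: k => [|k]; first by have [] := fP (0%N, 0%N).
    by have [/(leq_ltn_trans (leq0n _))] := fP (k.+1, n k).
  + by move=> j jJ; split=> [k|l k]; have [[cD cG] _ _ _] := DG k j jJ.
  + move=> j jJ l; split; apply: cvg0_invS => // k; have [_ h1 /(_ l)[h2 h3 h4] _] := DG k j jJ.
    * exact: h1.
    * exact: h2.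
    * exact: h3.
    * exact: h4.
  + move=> j jJ s l sl; apply: cvg0_invS => // k; have [_ _ _ h] := DG k j jJ; exact: h.
- apply: (criterion_densely_disjoint_hypercyclic he M1 hWinv WM hU) => J m J0 m0 eps e0.
  have [n [D [G [_ cDG lim cross]]]] := crit J m J0 m0.
  rewrite orthoproj_Lspan// in lim.
  (* Writing [j] as [i - J] with [i] in a finite ordinal type lets finitely many limits be used at
     one common index. *)
  have [k kP] : exists k0, forall k, (k0 <= k)%N -> forall i : 'I_J.*2.+1, forall s l : 'I_N,
      let j : int := i%:Z - J%:Z in
      [/\ opnorm (D j k - lproj e m) <= eps, opnorm (G l j k - lproj e m) <= eps,
        opnorm (forward_prod (W l) j (n k) * D j k) <= eps,
        opnorm (backward_prod (W l) j (n k) * G l j k) <= eps &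
        s != l -> opnorm (forward_prod_to (W s) j (n k) *
          backward_prod (W l) j (n k) * G l j k) <= eps].
    apply: eventually_forall => i; apply: eventually_forall => s; apply: eventually_forall => l.
    have jJ : (`|(i%:Z - J%:Z)%R| <= J)%N by have := ltn_ord i; lia.
    have [l1 l2 l3 l4] := lim _ jJ l.
    have [n1 P1] := cvg0_le l1 e0; have [n2 P2] := cvg0_le l2 e0.
    have [n3 P3] := cvg0_le l3 e0; have [n4 P4] := cvg0_le l4 e0.
    have [n5 P5] : exists n5, forall k, (n5 <= k)%N -> s != l ->
        opnorm (forward_prod_to (W s) (i%:Z - J%:Z) (n k) *
          backward_prod (W l) (i%:Z - J%:Z) (n k) * G l (i%:Z - J%:Z) k) <= eps.
      have [_|sl] := eqVneq s l; first by exists 0%N.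
      by have [n5 P5] := cvg0_le (cross _ jJ s l sl) e0; exists n5 => k nk _; exact: P5.
    exists (maxn n1 (maxn n2 (maxn n3 (maxn n4 n5)))) => k; rewrite !geq_max => /and5P[*].
    by split; [exact: P1|exact: P2|exact: P3|exact: P4|exact: P5].
  exists (n k), (fun j => D j k), (fun l j => G l j k) => j jJ.
  have iP : (`|(j + J%:Z)%R| < J.*2.+1)%N by lia.
  have {}kP s l := kP k (leqnn k) (Ordinal iP) s l.
  have jE : (Ordinal iP : nat)%:Z - J%:Z = j by rewrite /=; lia.
  rewrite jE in kP; split.
  + by have [cD cG] := cDG j jJ; split=> // l; exact: cG.
  + by have [] := kP (Ordinal N0) (Ordinal N0).
  + by move=> l; have [_ h1 h2 h3 _] := kP l l; split.
  + by move=> s l sl; have [_ _ _ _] := kP s l; exact.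
Qed.
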